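(* Let $H^\ell$ be a labelled bipartite graph. The class of weakly $H^\ell$-free bipartite graphs has bounded clique-width if and only if one of the following holds: (1) $H^\ell=(sP_1)^b$ or $H^\ell=(sP_1)^{\overline{b}}$ for some integer $s\geq 1$; (2) $H^\ell \subseteq_{li} (2P_1+P_3)^b$ or $H^\ell \subseteq_{li} (2P_1+P_3)^{\overline{b}}$; (3) $H^\ell \subseteq_{li} (P_1+P_5)^b$ or $H^\ell \subseteq_{li} (P_1+P_5)^{\overline{b}}$; (4) the underlying graph $H$ is an induced subgraph of $P_2+P_4$; (5) the underlying graph $H$ is an induced subgraph of $P_6$.
   Context: A labelled bipartite graph $H^\ell=(B^\ell_H,W^\ell_H,E_H)$ is a bipartite graph $H$ together with a black-and-white labelling $\ell$, i.e. an ordered partition of $V_H$ into two (possibly empty) independent sets $B^\ell_H$ (black) and $W^\ell_H$ (white). For labelled bipartite graphs, $H_1^{\ell_1}\subseteq_{li} H_2^{\ell_2}$ means $H_1$ is an induced subgraph of $H_2$ with $B^{\ell_1}_{H_1}\subseteq B^{\ell_2}_{H_2}$ and $W^{\ell_1}_{H_1}\subseteq W^{\ell_2}_{H_2}$ (up to isomorphism of labelled graphs, i.e. graph isomorphisms preserving colours). An (unlabelled) bipartite graph $G$ is weakly $H^\ell$-free if there exists a bipartition $(B_G,W_G)$ of $G$ into two independent sets such that $H^\ell \not\subseteq_{li} (B_G,W_G,E_G)$. The opposite labelling $\overline{\ell}$ swaps the colours: $H^{\overline{\ell}}=(W^\ell_H,B^\ell_H,E_H)$. For a bipartite graph $H$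 such that all black-and-white labellings maximizing the number of black vertices are isomorphic, $b$ denotes one such labelling. Concretely: $(sP_1)^b$ has all $s$ vertices black; $(2P_1+P_3)^b$ has the two isolated vertices and the two ends of $P_3$ black and the middle vertex of $P_3$ white; $(P_1+P_5)^b$ has the isolated vertex and the 1st, 3rd, 5th vertices of $P_5$ black and the 2nd, 4th white. $P_r$ is the path on $r$ vertices, $+$ is disjoint union, $sP_1$ is the edgeless graph on $s$ vertices. Clique-width: the minimum number of labels needed to construct a graph using creation of a single labelled vertex, disjoint union, joining all vertices of label $i$ to all of label $j$ ($i\ne j$), and relabelling $i$ to $j$; a class has bounded clique-width if some constant bounds the clique-width of all its members. *)

(* Defs.v *)
From mathcomp Require Import all_boot.
From mathcomp Require Import boolp.

Set Implicit Arguments.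
Unset Strict Implicit.
Unset Printing Implicit Defensive.

Record sgraph := SGraph {
  vertex :> finType;
  adj : rel vertex;
  adj_sym : symmetric adj;
  adj_irr : irreflexive adj }.

Arguments SGraph : clear implicits.

Definition embedding (G1 G2 : sgraph) (f : G1 -> G2) : Prop :=
  injective f /\ forall x y, adj (f x) (f y) = adj x y.

Definition isomorphism (G1 G2 : sgraph) (f : G1 -> G2) : Prop :=
  bijective f /\ forall x y, adj (f x) (f y) = adj x y.

Definition giso (G1 G2 : sgraph) : Prop :=
  exists f : G1 -> G2, isomorphism f.

Definition induced_sub (G1 G2 : sgraph) : Prop :=
  exists f : G1 -> G2, embedding f.

Section Path.
Variable n : nat.
Definition path_adj (i j : 'I_n) : bool := (i.+1 == j :> nat) || (j.+1 == i :> nat).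
Lemma path_adj_sym : symmetric path_adj.
Proof. by move=> i j; rewrite /path_adj orbC. Qed.
Lemma path_adj_irr : irreflexive path_adj.
Proof. by move=> i; rewrite /path_adj orbb gtn_eqF. Qed.
Definition P : sgraph := SGraph 'I_n path_adj path_adj_sym path_adj_irr.
End Path.

Section Edgeless.
Variable s : nat.
Definition edgeless_adj (i j : 'I_s) : bool := false.
Lemma edgeless_adj_sym : symmetric edgeless_adj. Proof. by []. Qed.
Lemma edgeless_adj_irr : irreflexive edgeless_adj. Proof. by []. Qed.
Definition sP1 : sgraph :=
  SGraph 'I_s edgeless_adj edgeless_adj_sym edgeless_adj_irr.
End Edgeless.

Section DisjointUnion.
Variables G1 G2 : sgraph.
Definition gunion_adj (u v : G1 + G2) : bool :=
  match u, v with
  | inl x, inl y => adj x y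
  | inr x, inr y => adj x y
  | _, _ => false
  end.
Lemma gunion_adj_sym : symmetric gunion_adj.
Proof. by case=> x [] y //=; rewrite adj_sym. Qed.
Lemma gunion_adj_irr : irreflexive gunion_adj.
Proof. by case=> x /=; rewrite adj_irr. Qed.
Definition gunion : sgraph :=
  SGraph (G1 + G2)%type gunion_adj gunion_adj_sym gunion_adj_irr.
End DisjointUnion.

Definition independent (G : sgraph) (A : {set G}) : bool :=
  [forall x in A, forall y in A, ~~ adj x y].

Definition bipartition (G : sgraph) (B W : {set G}) : bool :=
  [&& B :|: W == [set: G], [disjoint B & W], independent B & independent W].

Record lbigraph := LBigraph {
  ugraph :> sgraph;
  black : {set ugraph};
  white : {set ugraph};
  black_white : bipartition black white }.

Arguments LBigraph : clear implicits.

Definition li_sub (H1 H2 : lbigraph) : Prop :=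
  exists f : H1 -> H2,
    [/\ embedding f,
        forall x, x \in black H1 -> f x \in black H2 &
        forall x, x \in white H1 -> f x \in white H2].

Definition liso (H1 H2 : lbigraph) : Prop :=
  exists f : H1 -> H2,
    [/\ isomorphism f,
        forall x, (f x \in black H2) = (x \in black H1) &
        forall x, (f x \in white H2) = (x \in white H1)].

Lemma bipartition_swap (G : sgraph) (B W : {set G}) :
  bipartition B W -> bipartition W B.
Proof.
by case/and4P=> UBW dBW iB iW; apply/and4P; split; rewrite 1?setUC 1?disjoint_sym.
Qed.

Definition opposite (H : lbigraph) : lbigraph :=
  LBigraph (ugraph H) (white H) (black H) (bipartition_swap (black_white H)).

Definition weakly_free (H : lbigraph) (G : sgraph) : Prop :=
  exists (B W : {set G}) (bw : bipartition B W), ~ li_sub H (LBigraph G B W bw).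

Lemma sP1_b_proof s : @bipartition (sP1 s) [set: 'I_s] set0.
Proof.
apply/and4P; split; first by rewrite setU0.
- by rewrite -setI_eq0 setI0.
- by apply/'forall_implyP => x _; apply/'forall_implyP => y _.
- by apply/'forall_implyP => x; rewrite inE.
Qed.

Definition sP1_b (s : nat) : lbigraph :=
  LBigraph (sP1 s) [set: 'I_s] set0 (sP1_b_proof s).

(* Vertices are numbered from 0, so the 1st, 3rd, 5th, ... vertices are those
   of even index. *)
Lemma P_b_proof n :
  @bipartition (P n) [set i : 'I_n | ~~ odd i] [set i : 'I_n | odd i].
Proof.
apply/and4P; split.
- by apply/eqP/setP => i; rewrite !inE orNb.
- by rewrite -setI_eq0; apply/eqP/setP => i; rewrite !inE andNb.
- apply/'forall_implyP => i; rewrite inE => oi.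
  apply/'forall_implyP => j; rewrite inE => oj.
  by apply/norP; split; apply/eqP => /(congr1 odd) /=; rewrite (negbTE oi) (negbTE oj).
- apply/'forall_implyP => i; rewrite inE => oi.
  apply/'forall_implyP => j; rewrite inE => oj.
  by apply/norP; split; apply/eqP => /(congr1 odd) /=; rewrite oi oj.
Qed.

Definition P_b (n : nat) : lbigraph :=
  LBigraph (P n) [set i : 'I_n | ~~ odd i] [set i : 'I_n | odd i] (P_b_proof n).

Section LabelledUnion.
Variables H1 H2 : lbigraph.
Definition lunion_black : {set gunion H1 H2} :=
  [set u | match u with inl x => x \in black H1 | inr x => x \in black H2 end].
Definition lunion_white : {set gunion H1 H2} :=
  [set u | match u with inl x => x \in white H1 | inr x => x \in white H2 end].
Lemma lunion_proof : bipartition lunion_black lunion_white.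
Proof.
have /and4P[/eqP U1 d1 b1 w1] := black_white H1.
have /and4P[/eqP U2 d2 b2 w2] := black_white H2.
apply/and4P; split.
- apply/eqP/setP => -[] x; rewrite !inE -in_setU.
    by rewrite U1 inE.
  by rewrite U2 inE.
- rewrite -setI_eq0; apply/eqP/setP => -[] x; rewrite !inE; apply/negbTE/andP.
    by case=> xb; rewrite (disjointFr d1 xb).
  by case=> xb; rewrite (disjointFr d2 xb).
- apply/'forall_implyP => -[] x; rewrite inE => xb;
  apply/'forall_implyP => -[] y; rewrite inE => yb //=.
    by move/'forall_implyP: b1 => /(_ x xb) /'forall_implyP; apply.
  by move/'forall_implyP: b2 => /(_ x xb) /'forall_implyP; apply.
- apply/'forall_implyP => -[] x; rewrite inE => xb;
  apply/'forall_implyP => -[] y; rewrite inE => yb //=.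
    by move/'forall_implyP: w1 => /(_ x xb) /'forall_implyP; apply.
  by move/'forall_implyP: w2 => /(_ x xb) /'forall_implyP; apply.
Qed.
Definition lunion : lbigraph :=
  LBigraph (gunion H1 H2) lunion_black lunion_white lunion_proof.
End LabelledUnion.

(* For sP1, 2P1+P3 and P1+P5 the labelling maximizing the number of black
   vertices colours each component with its own such labelling. *)
Definition twoP1_P3_b : lbigraph := lunion (sP1_b 2) (P_b 3).
Definition P1_P5_b : lbigraph := lunion (sP1_b 1) (P_b 5).

(* Graphs whose vertices carry one of k clique-width labels. *)
Record kgraph (k : nat) := KGraph { kg :> sgraph; lab : kg -> 'I_k }.

Arguments KGraph {k} kg lab.

Section Operations.
Variable k : nat.

Definition kvertex (i : 'I_k) : kgraph k := KGraph (P 1) (fun=> i).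

Definition kunion (G1 G2 : kgraph k) : kgraph k :=
  KGraph (gunion G1 G2)
    (fun u => match u with inl x => lab x | inr x => lab x end).

Section Join.
Variables (i j : 'I_k) (ij : i != j) (G : kgraph k).
Definition kjoin_adj (x y : G) : bool :=
  [|| adj x y, (lab x == i) && (lab y == j) | (lab x == j) && (lab y == i)].
Lemma kjoin_adj_sym : symmetric kjoin_adj.
Proof.
move=> x y; rewrite /kjoin_adj adj_sym; congr orb.
by rewrite orbC [(lab x == j) && _]andbC [(lab x == i) && _]andbC.
Qed.
Lemma kjoin_adj_irr : irreflexive kjoin_adj.
Proof.
move=> x; rewrite /kjoin_adj adj_irr /= [X in _ || X]andbC orbb.
by apply/andP => -[/eqP->]; rewrite (negbTE ij).
Qed.
Definition kjoin : kgraph k :=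
  KGraph (SGraph G kjoin_adj kjoin_adj_sym kjoin_adj_irr) (@lab k G).
End Join.

Definition krelabel (i j : 'I_k) (G : kgraph k) : kgraph k :=
  KGraph G (fun x => if lab x == i then j else lab x).

Inductive cwterm :=
| CwVertex (i : 'I_k)
| CwUnion (t1 t2 : cwterm)
| CwJoin (i j : 'I_k) (ij : i != j) (t : cwterm)
| CwRelabel (i j : 'I_k) (t : cwterm).

Fixpoint cweval (t : cwterm) : kgraph k :=
  match t with
  | CwVertex i => kvertex i
  | CwUnion t1 t2 => kunion (cweval t1) (cweval t2)
  | CwJoin i j ij t => kjoin ij (cweval t)
  | CwRelabel i j t => krelabel i j (cweval t)
  end.

(* Terms only build nonempty graphs; the first disjunct gives the empty graph
   clique-width 0. *)
Definition constructible (G : sgraph) : Prop :=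
  #|G| = 0 \/ exists t : cwterm, giso G (cweval t).

(* The two lemmas below show that #|G| labels suffice to construct G. *)
Lemma cwterm_edgeless (s : seq 'I_k) : uniq s -> s != [::] ->
  exists t : cwterm,
    [/\ forall x y : cweval t, adj x y = false,
        injective (@lab k (cweval t)) &
        forall i, i \in s <-> exists x : cweval t, lab x = i].
Proof.
elim: s => // i s IHs /= /andP[is' us] _.
have [->|s0] := eqVneq s [::].
  exists (CwVertex i); split => [x y|x y _|j] /=.
  - by rewrite /path_adj !ord1.
  - by rewrite (ord1 x) (ord1 y).
  - rewrite inE; split=> [/eqP->|[_ <-]]; [by exists ord0 | exact: eqxx].
have [t [t0 tinj ts]] := IHs us s0.
have fresh (x : cweval t) : lab x <> i.
  by move=> xi; case/negP: is'; apply/ts; exists x.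
exists (CwUnion (CwVertex i) t); split => /=.
- by case=> x [] y //=; rewrite /path_adj !ord1.
- case=> x [] y //= xy.
  + by rewrite (ord1 x) (ord1 y).
  + by case: (fresh y).
  + by case: (fresh x).
  + by rewrite (tinj _ _ xy).
- move=> j; rewrite inE; split=> [/orP[/eqP->|/ts[x <-]]|[[x|x] <-]].
  + by exists (inl ord0).
  + by exists (inr x).
  + by rewrite eqxx.
  + by apply/orP; right; apply/ts; exists x.
Qed.

Lemma cwterm_joins (t : cwterm) (s : seq ('I_k * 'I_k)) :
  exists (t' : cwterm) (f : cweval t -> cweval t'), bijective f /\
    forall x y, lab (f x) = lab x /\ adj (f x) (f y) =
      adj x y || (lab x != lab y) &&
        (((lab x, lab y) \in s) || ((lab y, lab x) \in s)).
Proof.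
elim: s => [|[i j] s [t' [f [fbij fE]]]].
  by exists t, id; split=> [|x y]; [exists id | rewrite !in_nil andbF orbF].
have [eij|nij] := boolP (i == j).
  exists t', f; split=> // x y; case: (fE x y) => -> ->; split=> //.
  rewrite !inE !xpair_eqE (eqP eij); have [//|nxy] := eqVneq (lab x) (lab y).
  have [xj|] := eqVneq (lab x) j; have [yj|] := eqVneq (lab y) j => //=.
  by rewrite xj yj eqxx in nxy.
exists (CwJoin nij t'), f; split=> // x y; case: (fE x y) (fE y x) => xE e [yE _].
split; first exact: xE.
rewrite /= /kjoin_adj e xE yE !inE !xpair_eqE.
have [nxy|nxy] := eqVneq (lab x) (lab y).
  rewrite nxy /= orbF [X in _ || (_ || X)]andbC orbb.
  have [->|_] := eqVneq (lab y) i; last by rewrite orbF.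
  by rewrite (negbTE nij) orbF.
rewrite /= -!orbA; congr orb.
rewrite [(lab y == i) && _]andbC.
by do 4!case: (_ == _); do 2!case: (_ \in _).
Qed.

End Operations.

Lemma constructible_ex (G : sgraph) : exists k, `[< constructible k G >].
Proof.
have [G0|Gn0] := eqVneq #|G| 0.
  by exists 0; apply/asboolP; left.
exists #|G|; apply/asboolP; right.
have sn0 : enum 'I_#|G| != [::] by rewrite -size_eq0 size_enum_ord.
have [t [t0 tinj ts]] := cwterm_edgeless (enum_uniq 'I_#|G|) sn0.
pose s := [seq (enum_rank p.1, enum_rank p.2) | p <- enum {: G * G} & adj p.1 p.2].
have ins (x y : G) : ((enum_rank x, enum_rank y) \in s) = adj x y.
  apply/mapP/idP => [[[u v]]|xy].
    by rewrite mem_filter /= => /andP[uv _] [/enum_rank_inj-> /enum_rank_inj->].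
  by exists (x, y); rewrite // mem_filter /= xy mem_enum.
have [t' [f [fbij fE]]] := cwterm_joins t s.
have tsurj i : exists x : cweval t, lab x == i.
  have /ts[x xi] : i \in enum 'I_#|G| by rewrite mem_enum.
  by exists x; apply/eqP.
pose g (i : 'I_#|G|) := xchoose (tsurj i).
have gK i : lab (g i) = i by apply/eqP; apply: (xchooseP (tsurj i)).
have Kg x : g (lab x) = x by apply: tinj; rewrite gK.
exists t', (f \o (g \o enum_rank)); split.
  apply: bij_comp => //; apply: bij_comp; last exact: enum_rank_bij.
  by exists (@lab _ (cweval t)).
move=> x y /=; have [_ ->] := fE (g (enum_rank x)) (g (enum_rank y)).
rewrite !gK !ins t0 /= [adj y x]adj_sym orbb.
have [->|//] := eqVneq x y; first by rewrite adj_irr andbF.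
by rewrite (inj_eq enum_rank_inj) => ->.
Qed.

Definition cliquewidth (G : sgraph) : nat := ex_minn (constructible_ex G).

Definition bounded_cliquewidth (C : sgraph -> Prop) : Prop :=
  exists c : nat, forall G : sgraph, C G -> cliquewidth G <= c.

(* Main.v *)
Require Import Defs.
From mathcomp Require Import all_boot.
From mathcomp Require Import boolp.

Set Implicit Arguments.
Unset Strict Implicit.
Unset Printing Implicit Defensive.

(* Both sides are equivalent to the absence in H of finitely many labelled
   patterns: a claw or an edgeless graph with parts of size 1 and 3, C_4 or an
   edgeless graph with parts of size 2, C_6 or 3P_2, and 2P_3 with both centres
   of the same colour.

   Each pattern p is avoided by bipartite graphs of unbounded clique-width: n^2
   cells (i, j) against n row and n column vertices, where cell (i, j) sees row
   k depending on how i and k compare, and sees column l iff j = l or iff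
   j <> l. In a term with k labels for such a graph, consider a smallest subterm
   containing all cells of some row or column; one of its two arguments meets at
   least n/2 columns (or rows) but contains none of them, which forces n/4
   different neighbourhoods outside this argument.

   Conversely, a labelled bipartite graph H with both colours and without these
   patterns has at most 4 vertices of each colour, and an exhaustive search
   embeds it in (2P_1+P_3)^b, (P_1+P_5)^b, their opposites, P_2+P_4 or P_6. The
   graphs G avoiding one of these have a vertex colouring with at most 3 colours
   such that every vertex subset U of size at least 2 splits into two nonempty
   parts between which adjacency only depends on the colours; this yields a
   construction of G with twice as many labels. For (2P_1+P_3)^b and (P_1+P_5)^b
   the neighbourhoods of the white vertices are laminar up to complementation,
   and P_2+P_4 is the bipartite complement of P_6. A P_6-free graph with an
   induced P_5 has a proper bimodule containing 2P_2; a maximal one, and the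
   vertices it does not see, determine a split. Without an induced P_5, a vertex
   of maximum degree in a connected bipartite graph sees the whole other side. *)

(** * Clique-width of graphs that split along a colouring *)

Lemma cwterm_relabels k (t : cwterm k) (s : seq ('I_k * 'I_k)) :
  exists (t' : cwterm k) (f : cweval t -> cweval t'), bijective f /\
    forall x y, lab (f x) = foldl (fun l p => if l == p.1 then p.2 else l) (lab x) s
      /\ adj (f x) (f y) = adj x y.
Proof.
elim: s t => [|[i j] s IHs] t; first by exists t, id; split=> //; exists id.
have [t' [f [fbij fE]]] := IHs (CwRelabel i j t).
by exists t', f; split=> // x y; have [-> ->] := fE x y.
Qed.

Section Split.
Variables (G : sgraph) (m : nat) (col : G -> 'I_m).

Definition splittable (U : {set G}) :=
  exists S : {set G}, [/\ S \subset U, S != set0, U :\: S != set0 &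
    exists q : 'I_m -> 'I_m -> bool,
      forall u v, u \in S -> v \in U :\: S -> adj u v = q (col u) (col v)].

(** The map [g] identifies the graph of [t] with the subgraph induced on [U], which spares a
    separate type for that subgraph. *)
Definition builds (U : {set G}) (L : G -> 'I_(m + m))
    (t : cwterm (m + m)) (g : cweval t -> G) : Prop :=
  [/\ injective g, forall u, u \in U <-> exists x, g x = u,
      forall x y, adj (g x) (g y) = adj x y & forall x, lab x = L (g x)].

Lemma builds_relabel U L L' t (g : cweval t -> G) (s : seq ('I_(m + m) * 'I_(m + m))) :
    (forall u, foldl (fun l p => if l == p.1 then p.2 else l) (L u) s = L' u) ->
    builds U L g ->
  exists t' (g' : cweval t' -> G), builds U L' g'.
Proof.
move=> LsL' [ginj gU gadj glab].
have [t' [f [[f' fK f'K] fE]]] := cwterm_relabels t s.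
exists t', (g \o f'); split=> /=.
- by apply: inj_comp => //; exact: can_inj f'K.
- move=> u; rewrite gU; split=> [[x <-]|[x <-]]; last by exists (f' x).
  by exists (f x); rewrite /= fK.
- by move=> x y; rewrite gadj -{2}(f'K x) -{2}(f'K y) (fE _ _).2.
- by move=> x; rewrite -{1}(f'K x) (fE _ (f' x)).1 glab LsL'.
Qed.

Lemma foldl_relabel_id (l : 'I_(m + m)) s :
    (forall p, p \in s -> l != p.1) ->
  foldl (fun l p => if l == p.1 then p.2 else l) l s = l.
Proof.
elim: s => //= p s IHs lP; rewrite (negbTE (lP p _)) ?mem_head //.
by apply: IHs => p' p's; apply: lP; rewrite inE p's orbT.
Qed.

(** A label that has been moved lies in the range of [sh'], disjoint from that of [sh], so later
    relabellings leave it alone: the sequence acts as a simultaneous shift. *)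
Lemma foldl_relabel (sh sh' : 'I_m -> 'I_(m + m)) (i : 'I_m) :
    injective sh -> (forall i j, sh i != sh' j) ->
  foldl (fun l p => if l == p.1 then p.2 else l) (sh i)
    [seq (sh i, sh' i) | i <- enum 'I_m] = sh' i.
Proof.
move=> shinj shsh'; have : i \in enum 'I_m by rewrite mem_enum.
elim: (enum 'I_m) => //= j s IHs; rewrite inE (inj_eq shinj).
have [-> _|_] := eqVneq i j; last exact: IHs.
by apply: foldl_relabel_id => p /mapP[i' _ ->] /=; rewrite eq_sym.
Qed.

(** Between stages every label lies in the left half. The labels of [U :\: S] move to the right
    half, so that joins between the halves only add edges across the split, and then move back. *)
Lemma splittable_builds :
  (forall U : {set G}, 1 < #|U| -> splittable U) ->
  forall U : {set G}, U != set0 ->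
  exists t (g : cweval t -> G), builds U (fun u => lshift m (col u)) g.
Proof.
move=> split U; have [n] := ubnP #|U|; elim: n U => // n IHn U ltUn U0; rewrite ltnS in ltUn.
have [U1|U1] := ltnP 1 #|U|; last first.
  have /cards1P[u ->] : #|U| == 1 by rewrite eqn_leq U1 card_gt0.
  exists (CwVertex (lshift m (col u))), (fun=> u); split=> //.
  - by move=> x y _; rewrite (ord1 x) (ord1 y).
  - move=> v; rewrite inE; split=> [/eqP ->|[_ ->] //]; by exists ord0.
  - by move=> x y; rewrite adj_irr /= /path_adj (ord1 x) (ord1 y).
have [S [SU S0 US0 [q qE]]] := split _ U1.
have cU : #|U| = #|S| + #|U :\: S|.
  by rewrite cardsD (setIidPr SU) subnKC // subset_leq_card.
have [|//|t1 [g1 [g1inj g1U g1adj g1lab]]] := IHn S.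
  by apply: leq_trans ltUn; rewrite cU -addn1 leq_add2l card_gt0.
have [|//|t2' [g2' b2']] := IHn (U :\: S).
  by apply: leq_trans ltUn; rewrite cU -add1n leq_add2r card_gt0.
have lneq i j : lshift m i != rshift m j :> 'I_(m + m) by rewrite eq_lrshift.
have rneq i j : rshift m i != lshift m j :> 'I_(m + m) by rewrite eq_rlshift.
have [t2 [g2 [g2inj g2U g2adj g2lab]]] :=
  builds_relabel (fun u => foldl_relabel (col u) (@lshift_inj m m) lneq) b2'.
pose g (x : cweval (CwUnion t1 t2)) := match x with inl x => g1 x | inr x => g2 x end.
pose s := [seq (lshift m p.1, rshift m p.2) | p <- enum {: 'I_m * 'I_m} & q p.1 p.2].
have ins i j : ((lshift m i, rshift m j) \in s) = q i j.
  apply/mapP/idP => [[[i' j']]|qij].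
    rewrite mem_filter => /andP[qij _] e.
    by rewrite (lshift_inj (congr1 fst e)) (rshift_inj (congr1 snd e)).
  by exists (i, j); rewrite // mem_filter mem_enum /= qij.
have insN i l : ((rshift m i, l) \in s) = false.
  by apply/mapP => -[p _ /(congr1 fst)/eqP]; rewrite eq_rlshift.
have insN' i l : ((l, lshift m i) \in s) = false.
  by apply/mapP => -[p _ /(congr1 snd)/eqP]; rewrite eq_lrshift.
have [t [f [[f' fK f'K] fE]]] := cwterm_joins (CwUnion t1 t2) s.
have S1 x : g1 x \in S by apply/g1U; exists x.
have S2 x : g2 x \in U :\: S by apply/g2U; exists x.
have S2' x : (g2 x \in S) = false by have := S2 x; rewrite inE => /andP[/negbTE].
have ginj : injective g.
  case=> x [] y //= xy.
  - by rewrite (g1inj _ _ xy).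
  - by have := S2 y; rewrite -xy inE S1.
  - by have := S2 x; rewrite xy inE S1.
  - by rewrite (g2inj _ _ xy).
pose L u := if u \in S then lshift m (col u) else rshift m (col u).
have bt : builds U L (g \o f').
  split.
  - by apply: inj_comp => //; exact: can_inj f'K.
  - move=> u; split=> [uU|[x <-] /=]; last first.
      case: (f' x) => y /=; first by apply: (subsetP SU).
      by have := S2 y; rewrite inE => /andP[].
    have [/g1U[x <-]|uS] := boolP (u \in S).
      by exists (f (inl x)); rewrite /= fK.
    have /g2U[x <-] : u \in U :\: S by rewrite inE uS.
    by exists (f (inr x)); rewrite /= fK.
  - move=> x y; rewrite -{2}(f'K x) -{2}(f'K y) (fE _ _).2 /=.
    case: (f' x) (f' y) => [x1|x2] [y1|y2] /=.
    + by rewrite !g1lab !insN' andbF orbF g1adj.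
    + by rewrite g1lab g2lab eq_lrshift ins insN orbF; exact: qE.
    + by rewrite g1lab g2lab eq_rlshift ins insN /= adj_sym; exact: qE.
    + by rewrite !g2lab !insN andbF orbF g2adj.
  - move=> x; rewrite -{1}(f'K x) (fE _ (f' x)).1 /L /=.
    by case: (f' x) => y /=; rewrite ?S1 ?S2' ?g1lab ?g2lab.
apply: (builds_relabel (s := [seq (rshift m i, lshift m i) | i <- enum 'I_m]) _ bt).
move=> u; rewrite /L; case: ifP => _; last exact: foldl_relabel (@rshift_inj m m) rneq.
by apply: foldl_relabel_id => p /mapP[i _ ->]; exact: lneq.
Qed.

Lemma splittable_cliquewidth :
  (forall U : {set G}, 1 < #|U| -> splittable U) -> cliquewidth G <= m + m.
Proof.
move=> split; rewrite /cliquewidth; case: ex_minnP => k _; apply; apply/asboolP.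
have [G0|Gn0] := eqVneq #|G| 0; [by left | right].
have [|t [g [ginj gU gadj _]]] := splittable_builds split (U := setT).
  by rewrite -card_gt0 cardsT lt0n.
have [g' gK] := choice (fun u => (gU u).1 (in_setT u)).
exists t, g'; split; last by move=> x y; rewrite -gadj !gK.
by exists g => // x; apply: ginj; rewrite gK.
Qed.
End Split.

(** * Splitting P_6-free bipartite graphs *)

Section P6free.
Variables (V : finType) (col : V -> bool) (e : rel V).
Hypothesis eC : symmetric e.
Hypothesis ecol : forall u v, e u v -> col v = ~~ col u.
Hypothesis noP6 : forall p1 p2 p3 p4 p5 p6,
  e p1 p2 -> e p2 p3 -> e p3 p4 -> e p4 p5 -> e p5 p6 ->
  ~~ e p1 p4 -> ~~ e p2 p5 -> ~~ e p3 p6 -> ~~ e p1 p6 -> False.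

(** Only pairs of different colours are compared, so the colour of [u] determines that of [v] and
    [q] needs a single argument. *)
Definition splits := exists2 S : {set V}, S != set0 /\ S != setT &
  exists q : bool -> bool, forall u v, u \in S -> v \notin S ->
    col v = ~~ col u -> e u v = q (col u).

Definition bimodule (M : {set V}) := forall u p q,
  u \notin M -> p \in M -> q \in M -> col p = col q -> e u p = e u q.

Let enc u v : col u = col v -> e u v = false.
Proof. by move=> c; apply/negP => /ecol; rewrite c; case: (col v). Qed.

(* Two vertices at distance 2 from v with incomparable neighbourhoods in N(v)
   agree outside N(v), as x - a - v - b - y is then an induced path. The bimodule
   consists of the connected component Q of x in the incomparability graph and of
   the vertices of N(v) that distinguish two vertices of Q. *)
Lemma P5_bimodule v x y a b :
    e v a -> e v b -> e x a -> ~~ e x b -> e y b -> ~~ e y a ->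
  exists M, [/\ bimodule M, v \notin M, x \in M /\ y \in M & a \in M /\ b \in M].
Proof.
move=> va vb xa xb yb ya.
have cx : col x = col v.
  by have := ecol xa; rewrite (ecol va) => /(congr1 negb); rewrite !negbK.
have cy : col y = col v.
  by have := ecol yb; rewrite (ecol vb) => /(congr1 negb); rewrite !negbK.
pose sub p q := [forall w, e v w ==> e p w ==> e q w].
have subP p q : reflect (forall w, e v w -> e p w -> e q w) (sub p q).
  apply: (iffP forallP) => [pq w vw pw|pq w].
    by move/implyP/(_ vw)/implyP/(_ pw): (pq w).
  by apply/implyP => vw; apply/implyP; exact: pq.
pose inc p q := [&& col p == col v, col q == col v, ~~ sub p q & ~~ sub q p].
have incC : symmetric inc.
  by move=> p q; rewrite /inc andbCA; do 2!congr andb; rewrite andbC.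
pose Q := [set q | connect inc x q].
have inQ (A : pred V) : (forall p q, inc p q -> A p -> A q) ->
    forall q, q \in Q -> A q = A x.
  move=> Ainc q; rewrite inE => xq.
  have cl : closed inc A.
    by apply: intro_closed => [|p p' pp']; [exact: sym_connect_sym | exact: Ainc].
  exact/esym/(closed_connect cl).
have colQ q : q \in Q -> col q = col v.
  move=> /(inQ (fun q => col q == col v)) H; apply/eqP; rewrite H ?cx ?eqxx //.
  by move=> p p' /and4P[].
have xQ : x \in Q by rewrite inE.
have xy : inc x y.
  apply/and4P; split; rewrite ?cx ?cy //; apply/subP.
    by move/(_ a va xa); apply/negP.
  by move/(_ b vb yb); apply/negP.
have yQ : y \in Q by rewrite inE connect1.
pose D := [set w | [&& e v w, [exists q in Q, e w q] & [exists q in Q, ~~ e w q]]].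
(* As [v] sees its whole neighbourhood, every vertex is comparable with it. *)
have vQ : v \notin Q.
  apply/negP => /(inQ (fun q => q != v)); rewrite eqxx.
  have -> : x != v by apply: contraNneq xb => ->.
  move=> H; suff : false = true by [].
  apply: H => p q /and4P[_ _ /subP pq _] _; apply/eqP => qv.
  by apply: pq => w vw _; rewrite qv.
exists (Q :|: D); split.
- move=> u p q; rewrite in_setU negb_or => /andP[uQ uD].
  rewrite !in_setU => /orP[pQ|pD] /orP[qQ|qD] cpq.
  + have [uv|uv] := boolP (e v u); last first.
      (* If [u] saw [r] but not an incomparable [r'], then [u], [r], [w], [v], [w'], [r'] would be
         an induced $P_6$. *)
      have H s : s \in Q -> e u s = e u x.
        apply: (inQ (fun s => e u s)) => r r' /and4P[_ _ /subP rr' /subP r'r] ur.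
        apply/negPn/negP => ur'.
        case: rr' => w vw rw; apply/negPn/negP => r'w.
        case: r'r => w' vw' r'w'; apply/negPn/negP => rw'.
        apply: (@noP6 u r w v w' r') => //; rewrite 1?[e w v]eC 1?[e w' r']eC //.
          by rewrite eC.
        by rewrite [e w r']eC.
      by rewrite !H.
    have [up|up] := boolP (e u p).
      apply/esym/negPn; apply: contra uD => uq; rewrite inE uv /=; apply/andP; split.
        by apply/exists_inP; exists p.
      by apply/exists_inP; exists q.
    apply/esym/negbTE; apply: contra uD => uq; rewrite inE uv /=; apply/andP; split.
      by apply/exists_inP; exists q.
    by apply/exists_inP; exists p.
  + move: qD; rewrite inE => /and3P[/ecol vq _ _].
    by move: cpq; rewrite colQ // vq; case: (col v).
  + move: pD; rewrite inE => /and3P[/ecol vp _ _].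
    by move: cpq; rewrite [col q]colQ // vp; case: (col v).
  + move: pD qD; rewrite !inE.
    move=> /and3P[vp /exists_inP[p1 p1Q pp1] /exists_inP[p2 p2Q pp2]].
    move=> /and3P[vq /exists_inP[q1 q1Q qq1] /exists_inP[q2 q2Q qq2]].
    have [cu|cu] := eqVneq (col u) (col v); last first.
      have cu' : col u = ~~ col v by move: cu; case: (col u); case: (col v).
      by rewrite !enc // cu' ?(ecol vq) ?(ecol vp).
    (* Being outside [Q], [u] is comparable with all of [Q], and always in the same direction, since
       a change along an incomparable pair would make that pair comparable. So [u] sees all of [D]
       or none of it. *)
    have cmp r : r \in Q -> sub r u || sub u r.
      move=> rQ; have cr := colQ r rQ; rewrite -[_ || _]negbK negb_or; apply: contra uQ => ru.
      rewrite inE; rewrite inE in rQ; apply: connect_trans rQ (connect1 _).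
      by rewrite /inc cr cu !eqxx.
    have sub_trans s t r : sub s t -> sub t r -> sub s r.
      by move=> /subP st /subP tr; apply/subP => w vw sw; apply/tr/st.
    have subQ r : r \in Q -> sub r u = sub x u.
      move=> rQ; have := inQ (fun r => (r \in Q) && sub r u) _ _ rQ.
      rewrite rQ xQ /=; apply=> s t st /andP[sQ su].
      have tQ : t \in Q by rewrite inE; rewrite inE in sQ; apply: connect_trans (connect1 st).
      rewrite tQ; case/orP: (cmp _ tQ) => // ut.
      by case/and4P: st; rewrite (sub_trans _ _ _ su ut).
    have [xu|xu] := boolP (sub x u).
      have := subQ _ p1Q; have := subQ _ q1Q; rewrite xu => /subP q1u /subP p1u.
      have -> : e u p by rewrite p1u // eC.
      by rewrite q1u // eC.
    have up r : r \in Q -> sub u r.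
      by move=> rQ; have := cmp _ rQ; rewrite subQ // (negbTE xu).
    have /subP p2u := up _ p2Q; have /subP q2u := up _ q2Q.
    transitivity false; last apply/esym; apply/negbTE.
      by apply: contra pp2 => upp; rewrite eC p2u.
    by apply: contra qq2 => upp; rewrite eC q2u.
- by rewrite in_setU negb_or vQ inE enc.
- by rewrite !in_setU xQ yQ.
- by rewrite !in_setU !inE va vb /=; split; apply/orP; right; apply/andP; split;
   apply/exists_inP; [exists x | exists y | exists y | exists x]; rewrite // eC.
Qed.

(** A cut without edges is a split with constant [q]; hence a graph without splits is connected. *)
Lemma splits_cut (S : {set V}) : ~ splits -> S != set0 -> S != setT ->
  exists u v, [/\ u \in S, v \notin S & e u v].
Proof.
move=> nspl S0 ST; apply: contrapT => noedge; apply: nspl.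
exists S => //; exists (fun=> false) => u v uS vS _.
by apply/negbTE/negP => uv; apply: noedge; exists u, v.
Qed.

(** By connectedness an edge [s t] leaves the ball of radius 2 around [a]. Since [s] sees [t] and
    [a] does not, maximality of the degree of [a] gives a neighbour [b'] of [a] missed by [s], and
    [b'], [a], [b], [s], [t] is the path sought, with midpoint [b]. *)
Lemma max_degree_P5 (a u : V) : ~ splits ->
    (forall p, #|[set w | e p w]| <= #|[set w | e a w]|) ->
    col u = ~~ col a -> ~~ e a u ->
  exists v x y p q, [/\ e v p, e v q & e x p] /\ [/\ ~~ e x q, e y q & ~~ e y p].
Proof.
move=> nspl amax cu au.
pose N2 := [set p | [exists b, e a b && e b p]].
pose S := [set p | [|| p == a, e a p | [exists b, e a b && e b p]]].
have [|||s [t [sS tS st]]] := @splits_cut S.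
- by [].
- by apply/set0Pn; exists a; rewrite inE eqxx.
- apply/negP => /eqP ST; have : u \in S by rewrite ST inE.
  rewrite inE (negbTE au) /=; case/orP => [/eqP ua|/existsP[b /andP[/ecol ab /ecol bu]]].
    by move: cu; rewrite ua; case: (col a).
  by move: bu; rewrite cu ab; case: (col a).
move: tS; rewrite inE !negb_or => /and3P[ta nat /existsPn nt].
move: sS; rewrite inE => /or3P[/eqP sa|es|/existsP[b /andP[ab bs]]].
- by rewrite sa (negbTE nat) in st.
- by have := nt s; rewrite es st.
have [b' ab' sb'] : exists2 b', e a b' & ~~ e s b'.
  apply: contrapT => H; have := amax s; rewrite leqNgt => /negP; apply.
  apply: proper_card; apply/properP; split.
    apply/subsetP => w; rewrite !inE => aw; apply/negPn/negP => sw; apply: H.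
    by exists w.
  by exists t; rewrite !inE.
by exists b, b', t, a, s; split; split=> //; rewrite eC.
Qed.

Definition proper_2K2_bimodule (M : {set V}) := [/\ bimodule M, M != setT &
  exists x y a b, [/\ x \in M, y \in M, a \in M & b \in M] /\
    [/\ col x = col y, e x a, e y b, ~~ e x b & ~~ e y a]].

(** A vertex of maximum degree either sees the whole other side and splits off alone, or yields an
    induced $P_5$; the bimodule of the latter omits its midpoint and contains its two end edges. *)
Lemma exists_proper_2K2_bimodule : 1 < #|V| -> ~ splits ->
  exists M, proper_2K2_bimodule M.
Proof.
move=> V1 nspl; have /card_gt0P[v0 _] : 0 < #|V| by apply: leq_trans V1.
pose deg p := #|[set w | e p w]|.
have [a _ amax] := @arg_maxnP _ v0 xpredT deg isT.
have [dom|] := boolP [forall u, (col u == ~~ col a) ==> e a u].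
  case: nspl; exists [set a].
    split; first by apply/set0Pn; exists a; rewrite inE.
    by apply/eqP => aT; move: V1; rewrite -cardsT -aT cards1.
  exists (fun=> true) => u v; rewrite inE => /eqP-> _ /eqP.
  exact/implyP/(forallP dom).
rewrite negb_forall => /existsP[u]; rewrite negb_imply => /andP[/eqP cu au].
have [|v [x [y [p [q [[vp vq xp] [xq yq yp]]]]]]] := max_degree_P5 nspl _ cu au.
  by move=> p; exact: amax.
have [M [bM vM [xM yM] [pM qM]]] := P5_bimodule vp vq xp xq yq yp.
exists M; split=> //; last first.
  exists x, y, p, q; split; split=> //.
  by apply: negb_inj; rewrite -(ecol xp) -(ecol yq) (ecol vp) (ecol vq).
by apply: contraNneq vM => ->; rewrite inE.
Qed.

Section MaximalBimodule.
Variable M : {set V}.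
Hypothesis nspl : ~ splits.
Hypothesis bM : bimodule M.
Hypothesis MT : M != setT.
Hypothesis M2K2 : exists x y a b, [/\ x \in M, y \in M, a \in M & b \in M] /\
    [/\ col x = col y, e x a, e y b, ~~ e x b & ~~ e y a].
Hypothesis Mmax : forall N : {set V}, bimodule N -> M \subset N -> N = M \/ N = setT.

Let M2K2c c : exists x y a b, [/\ x \in M, y \in M, a \in M & b \in M] /\
  [/\ e x a, e y b, ~~ e x b & ~~ e y a] /\
  [/\ col x = c, col y = c, col a = ~~ c & col b = ~~ c].
Proof.
have [x [y [a [b [[xM yM aM bM'] [xy xa yb xb ya]]]]]] := M2K2.
have ca := ecol xa; have cb := ecol yb; rewrite -xy in cb.
have [<-|cx] := eqVneq (col x) c; first by exists x, y, a, b.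
have cx' : c = ~~ col x by move: cx; case: (col x); case: c.
exists a, b, x, y; rewrite cx' ca cb -xy negbK.
by split; [|split]; split; rewrite // eC.
Qed.

(** Since [M] is a bimodule, a vertex of [Pl] sees all vertices of [M] of the other colour, while a
    vertex of [R] sees nothing of [M]. *)
Let Pl := [set u | (u \notin M) && [exists p in M, e u p]].
Let R := [set u | (u \notin M) && ~~ [exists p in M, e u p]].

Let PlM u p : u \in Pl -> p \in M -> col p = ~~ col u -> e u p.
Proof.
rewrite inE => /andP[uM /exists_inP[q qM uq]] pM cp.
by rewrite (bM uM pM qM) // cp (ecol uq).
Qed.

Let RM u p : u \in R -> p \in M -> ~~ e u p.
Proof. by rewrite inE negb_exists_in => /andP[_ /forall_inP]; apply. Qed.

Let PlR u : u \in Pl -> u \in R -> False.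
Proof. by rewrite !inE => /andP[_ ->]; rewrite andbF. Qed.

Let PlNM u : u \in Pl -> u \notin M.
Proof. by rewrite inE => /andP[]. Qed.

Let RNM u : u \in R -> u \notin M.
Proof. by rewrite inE => /andP[]. Qed.

Let outM u : u \notin M -> u \in Pl \/ u \in R.
Proof. by rewrite !inE => -> /=; case: [exists p in M, e u p]; [left | right]. Qed.

Let M0 : M != set0.
Proof. by have [x [_ [_ [_ [[xM _ _ _] _]]]]] := M2K2; apply/set0Pn; exists x. Qed.

(* Adding to M the vertices of Pl that miss some vertex of Pl of the other colour
   preserves bimodules, so there are none by maximality. *)
Let Pl_complete z c : z \in Pl -> c \in Pl -> col c = ~~ col z -> e z c.
Proof.
pose Z0 := [set z in Pl | [exists c in Pl, (col c == ~~ col z) && ~~ e z c]].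
(* Otherwise [r], [w], [a], [x], [d], [y] is an induced $P_6$, where [a], [x], [y] come from the
   copy of $2P_2$ in [M] and [d] is a vertex of [Pl] missed by [w]. *)
have Z0R w r : w \in Z0 -> r \in R -> ~~ e w r.
  rewrite inE => /andP[wPl /exists_inP[d dPl /andP[/eqP cd wd]]] rR.
  apply/negP => wr.
  have [x [y [a [b [[xM yM aM bM'] [[xa yb xb ya] [cx cy ca cb]]]]]]] := M2K2c (col w).
  apply: (@noP6 r w a x d y) => //; do ?by rewrite eC.
  - by apply: PlM.
  - by rewrite eC PlM // cd negbK.
  - by rewrite PlM // cd negbK.
  - exact: RM.
  - exact: RM.
move=> zPl cPl cz; apply/negPn/negP => zc.
have zZ0 : z \in Z0.
  by rewrite inE zPl; apply/exists_inP; exists c; rewrite // cz eqxx.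
have : bimodule (M :|: Z0).
  move=> u p q; rewrite in_setU negb_or => /andP[uM uZ0] pN qN cpq.
  have [uPl|uR] := outM uM.
    have H t : t \in M :|: Z0 -> e u t = (col t == ~~ col u).
      move=> tN; have [ct|ct] := eqVneq (col t) (~~ col u); last first.
        by apply/negP => /ecol; apply/eqP.
      case/setUP: tN => [tM|]; first exact: PlM.
      rewrite inE => /andP[tPl _]; move: uZ0; rewrite inE uPl /= negb_exists_in.
      by move=> /forall_inP/(_ t tPl); rewrite ct eqxx /= negbK.
    by rewrite !H // cpq.
  have H t : t \in M :|: Z0 -> e u t = false.
    by case/setUP => tN; apply/negbTE; [exact: RM | rewrite eC; exact: Z0R].
  by rewrite !H.
case/Mmax; first exact: subsetUl.
  by move=> /setP/(_ z); rewrite inE zZ0 orbT (negbTE (PlNM zPl)).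
(* Here all vertices outside [M] belong to [Pl], so [M] itself is a split. *)
move=> NT; apply: nspl; exists M => //; exists (fun=> true) => u v uM vM cv.
have : v \in M :|: Z0 by rewrite NT inE.
rewrite inE (negbTE vM) /= inE => /andP[vPl _].
by rewrite eC PlM // cv negbK.
Qed.

(* The union of the components of R attached to z. *)
Definition att z := [set t in R | e z t || [exists s in R, e t s && e z s]].

Let attR z t : t \in att z -> t \in R. Proof. by rewrite inE => /andP[]. Qed.

Let att_adj z t : t \in att z -> col t = ~~ col z -> e z t.
Proof.
rewrite inE => /andP[_ /orP[//|/exists_inP[s _ /andP[/ecol st /ecol zs]]]] ct.
by move: st; rewrite zs ct; case: (col z).
Qed.

Let adj_att z t : t \in R -> e z t -> t \in att z.
Proof. by move=> tR zt; rewrite inE tR zt. Qed.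

(** If [z] reached [s] through [r] but missed the next vertex [t], then [x], [a], [z], [r], [s], [t]
    would be an induced $P_6$ with [x], [a] in [M]. So the two steps allowed in [att] already
    exhaust the components. *)
Let att_closed z s t : z \in Pl -> s \in att z -> t \in R -> e s t -> t \in att z.
Proof.
move=> zPl sz tR st; have sR := attR sz; rewrite inE tR /=.
have [cs|cs] := eqVneq (col s) (~~ col z).
  by apply/orP; right; apply/exists_inP; exists s; rewrite // eC st att_adj.
apply/orP; left; move: sz; rewrite inE sR /=.
case/orP => [/ecol zs|/exists_inP[r rR /andP[sr zr]]]; first by rewrite zs eqxx in cs.
apply/negPn/negP => zt.
have [x [y [a [b [[xM yM aM bM'] [[xa yb xb ya] [cx cy ca cb]]]]]]] := M2K2c (col z).
apply: (@noP6 x a z r s t) => //; do ?by rewrite eC.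
- by rewrite eC; exact: PlM.
- by rewrite eC; exact: RM.
- by rewrite eC; exact: RM.
- by rewrite eC; exact: RM.
Qed.

(* Otherwise one of two larger bimodules N and M :|: K contradicts the maximality
   of M: N gathers the vertices of Pl not attached to the component of e0 and all
   components of R attached to them, and K is the union of the components
   attached to every vertex of Pl. *)
Let attached_edge z0 e0 d0 :
  z0 \in Pl -> e0 \in R -> d0 \in R -> e z0 e0 -> e e0 d0 -> False.
Proof.
move=> z0Pl e0R d0R z0e0 e0d0.
have d0e0 : e d0 e0 by rewrite eC.
pose Z := [set z in Pl | e0 \notin att z].
pose N := M :|: (Z :|: \bigcup_(z in Z) att z).
have NP t : t \in N -> [\/ t \in M, t \in Z | exists2 z, z \in Z & t \in att z].
  by case/setUP => [?|/setUP[?|/bigcupP?]]; [constructor 1|constructor 2|constructor 3].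
have bN : bimodule N.
  move=> u p q uN pN qN cpq; move: uN.
  rewrite !in_setU !negb_or => /and3P[uM uZ /bigcupP uA].
  have [uPl|uR] := outM uM; last first.
    have H t : t \in N -> e u t = false.
      move=> /NP[tM|tZ|[z zZ tz]]; apply/negbTE; first exact: RM.
        apply/negP => ut; apply: uA; exists t => //.
        by apply: adj_att; rewrite // eC.
      apply/negP => ut; apply: uA; exists z => //.
      move: zZ; rewrite inE => /andP[zPl _].
      by apply: att_closed tz uR _; rewrite // eC.
    by rewrite !H.
  have e0u : e0 \in att u by move: uZ; rewrite inE uPl /= negbK.
  have d0u : d0 \in att u by apply: att_closed e0u _ _.
  (* The edge [e0 d0] is oriented so that [f] is the endpoint that [u] sees. *)
  have [f [g [fu gu fg cf eg]]] : exists f g, [/\ f \in att u, g \in att u, e f g,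
      col f = ~~ col u & (g == e0) || (g == d0)].
    have [ce|ce] := eqVneq (col e0) (~~ col u).
      by exists e0, d0; rewrite eqxx orbT.
    exists d0, e0; rewrite eqxx; split=> //; rewrite (ecol e0d0).
    by move: ce; case: (col e0); case: (col u).
  have fR := attR fu; have gR := attR gu; have gf : e g f by rewrite eC.
  have H t : t \in N -> e u t = (col t == ~~ col u).
    move=> tN; have [ct|ct] := eqVneq (col t) (~~ col u); last first.
      by apply/negP => /ecol; apply/eqP.
    case/NP: tN => [tM|tZ|[z zZ tz]]; first exact: PlM.
      by move: tZ; rewrite inE => /andP[tPl _]; apply: Pl_complete.
    move: (zZ); rewrite inE => /andP[zPl e0z].
    have tR := attR tz.
    have gz : g \notin att z.
      apply: contra e0z => gz; case/orP: eg => /eqP ge; first by rewrite -ge.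
      by apply: att_closed zPl _ e0R d0e0; rewrite -ge.
    have fz : f \notin att z by apply: contra gz => fz; apply: att_closed fz _ _.
    (* A vertex [t] missed by [u] ends an induced $P_6$ that starts with [g], [f], [u]: it continues
       with [a], [z] for some [a] in [M] if [z] and [u] have the same colour, and with [z], [s]
       otherwise. *)
    apply/negPn/negP => ut.
    have uf : e u f by apply: att_adj.
    have gt : ~~ e g t.
      by apply: contra gz => gt; apply: att_closed tz _ _; rewrite // eC.
    have [cz|cz] := eqVneq (col z) (col u).
      have [x [y [a [b [[xM yM aM bM'] [[xa yb xb ya] [cx cy ca cb]]]]]]] := M2K2c (col u).
      apply: (@noP6 g f u a z t) => //.
      - by rewrite eC.
      - exact: PlM.
      - by rewrite eC PlM // ca cz.
      - by apply: att_adj; rewrite // cz.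
      - exact: RM.
      - by apply: contra fz => fz; apply: adj_att; rewrite // eC.
    have cz' : col z = ~~ col u by move: cz; case: (col z); case: (col u).
    have [s sR /andP[ts zs]] : exists2 s, s \in R & e t s && e z s.
      move: (tz); rewrite inE tR => /orP[/ecol|/exists_inP//].
      by rewrite ct cz'; case: (col u).
    have sz : s \in att z by apply: adj_att.
    apply: (@noP6 g f u z s t) => //.
    - by rewrite eC.
    - exact: Pl_complete.
    - by rewrite eC.
    - by apply: contra gz => gz; apply: adj_att; rewrite // eC.
    - by apply: contra fz => fs; apply: att_closed sz _ _; rewrite // eC.
  by rewrite !H // cpq.
have e0N : e0 \notin N.
  apply/negP => /NP[e0M|e0Z|[z]]; first by have := RNM e0R; rewrite e0M.
    by move: e0Z; rewrite inE => /andP[/PlR/(_ e0R)].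
  by rewrite inE => /andP[_ /negbTE->].
case: (Mmax bN); first exact: subsetUl; last by move=> NT; rewrite NT inE in e0N.
(* As [N] adds nothing to [M], the set [Z] is empty, so every vertex of [Pl] is attached to the
   component of [e0]. *)
move=> NM; have allZ z : z \in Pl -> e0 \in att z.
  move=> zPl; apply/negPn/negP => e0z.
  have : z \in N by rewrite !in_setU [z \in Z]inE zPl e0z orbT.
  by rewrite NM (negbTE (PlNM zPl)).
pose K := \bigcap_(z in Pl) att z.
have KR t : t \in K -> t \in R by move=> /bigcapP/(_ _ z0Pl)/attR.
have bK : bimodule (M :|: K).
  move=> u p q; rewrite in_setU negb_or => /andP[uM uK] pN qN cpq.
  have [uPl|uR] := outM uM.
    have H t : t \in M :|: K -> e u t = (col t == ~~ col u).
      move=> tN; have [ct|ct] := eqVneq (col t) (~~ col u); last first.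
        by apply/negP => /ecol; apply/eqP.
      case/setUP: tN => [tM|/bigcapP/(_ _ uPl) tu]; first exact: PlM.
      exact: att_adj.
    by rewrite !H // cpq.
  have H t : t \in M :|: K -> e u t = false.
    case/setUP => tN; apply/negbTE; first exact: RM.
    apply: contra uK => ut; apply/bigcapP => z zPl.
    move/bigcapP/(_ _ zPl): tN => tz.
    by apply: att_closed tz _ _; rewrite // eC.
  by rewrite !H.
have e0K : e0 \in K by apply/bigcapP.
case: (Mmax bK); first exact: subsetUl.
  by move=> /setP/(_ e0); rewrite inE e0K orbT (negbTE (RNM e0R)).
move=> /setP/(_ z0); rewrite in_setU in_setT (negbTE (PlNM z0Pl)) /= => /KR.
exact: PlR.
Qed.

(** First, [R] is independent: an edge leaving its set of non-isolated vertices could only lead to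
    [Pl], against [attached_edge]. Then the vertices of [Pl] of one colour and the vertices of [R]
    of the other colour together form a split. *)
Lemma maximal_bimodule_absurd : False.
Proof.
have indR r s : r \in R -> s \in R -> ~~ e r s.
  move=> rR sR; apply/negP => rs.
  pose S := [set r in R | [exists s in R, e r s]].
  have rS : r \in S by rewrite inE rR; apply/exists_inP; exists s.
  have [|||u [v [uS vS uv]]] := @splits_cut S.
  - exact: nspl.
  - by apply/set0Pn; exists r.
  - case/set0Pn: M0 => x xM; apply/negP => /eqP/setP/(_ x).
    by rewrite inE [RHS]inE => /andP[/RNM/negP].
  move: uS; rewrite inE => /andP[uR /exists_inP[w wR uw]].
  have [vM|/outM[vPl|vR]] := boolP (v \in M); first by rewrite (negbTE (RM uR vM)) in uv.
    by apply: (attached_edge vPl uR wR); rewrite // eC.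
  by move: vS; rewrite inE vR => /exists_inP[]; exists u; rewrite // eC.
have [|||p [z [pM zM pz]]] := @splits_cut M.
- exact: nspl.
- exact: M0.
- exact: MT.
have zPl : z \in Pl.
  by rewrite inE zM; apply/exists_inP; exists p; rewrite // eC.
pose S := [set u | ((u \in Pl) && (col u == col z)) || ((u \in R) && (col u != col z))].
have inS u : (u \in S) =
    ((u \in Pl) && (col u == col z)) || ((u \in R) && (col u != col z)) by rewrite inE.
apply: nspl; exists S.
  split; first by apply/set0Pn; exists z; rewrite inS zPl eqxx.
  apply/eqP => /setP/(_ p); rewrite inS in_setT.
  by case/orP => /andP[]; [move/PlNM/negP | move/RNM/negP].
exists (fun c => c == col z) => u v; rewrite !inS negb_or !negb_and negbK.
move=> /orP[/andP[uPl /eqP cu]|/andP[uR cu]] /andP[vPl vR] cv.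
  rewrite cu eqxx; have [vM|/outM[vP|vR']] := boolP (v \in M).
  - exact: PlM.
  - exact: Pl_complete.
  - by move: vR; rewrite vR' cv cu; case: (col z).
rewrite (negbTE cu); apply/negbTE; have [vM|/outM[vP|vR']] := boolP (v \in M).
- exact: RM.
- by move: vPl cu; rewrite vP cv; case: (col u); case: (col z).
- exact: indR.
Qed.
End MaximalBimodule.

Lemma P6free_splits : 1 < #|V| -> splits.
Proof.
move=> V1; apply: contrapT => nspl.
have [M0 M0P] := exists_proper_2K2_bimodule V1 nspl.
have M0P' : `[< proper_2K2_bimodule M0 >] by apply/asboolP.
have [M /asboolP[bM MT M2K2] Mmax] :=
  @arg_maxnP _ M0 (fun M => `[< proper_2K2_bimodule M >]) (fun M => #|M|) M0P'.
apply: (maximal_bimodule_absurd nspl bM MT M2K2) => N bN MN.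
have [->|NT] := eqVneq N setT; [by right | left].
(* A larger bimodule keeps the copy of $2P_2$, so maximality extends to all proper bimodules
   containing [M]. *)
apply/esym/eqP; rewrite eqEcard MN; apply: Mmax; apply/asboolP; split=> //.
have [x [y [a [b [[xM yM aM bM'] H]]]]] := M2K2.
by exists x, y, a, b; split=> //; split; apply: (subsetP MN).
Qed.
End P6free.

Lemma bipartition_adj (G : sgraph) (B W : {set G}) : bipartition B W ->
  forall u v, adj u v -> (v \in B) = ~~ (u \in B).
Proof.
case/and4P=> /eqP UBW dBW /'forall_implyP iB /'forall_implyP iW u v uv.
have inW x : (x \in W) = ~~ (x \in B).
  have : x \in B :|: W by rewrite UBW inE.
  rewrite inE; have [xB _|//] := boolP (x \in B).
  by rewrite (disjointFr dBW xB).
have [uB|uB] := boolP (u \in B).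
  have /'forall_implyP/(_ v) := iB u uB.
  by rewrite uv; case: (v \in B) => // /(_ isT).
have uW : u \in W by rewrite inW.
have /'forall_implyP/(_ v) := iW u uW.
by rewrite uv inW; case: (v \in B) => // /(_ isT).
Qed.

Lemma bipartition_white (G : sgraph) (B W : {set G}) : bipartition B W ->
  forall u, (u \in W) = ~~ (u \in B).
Proof.
case/and4P=> /eqP UBW dBW _ _ x.
have : x \in B :|: W by rewrite UBW inE.
rewrite inE; have [xB _|//] := boolP (x \in B).
by rewrite (disjointFr dBW xB).
Qed.

(** * Labelled patterns and classes of bounded clique-width *)

(* A biadjacency matrix is given by its rows, indexed by white vertices. *)
Definition entry (m : seq (seq bool)) i j := nth false (nth [::] m j) i.

Definition occurrence (G : lbigraph) (b w : nat) (p : nat -> nat -> bool) (x y : nat -> G) :=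
  [/\ forall i, i < b -> x i \in black G,
    forall j, j < w -> y j \in white G,
    {in gtn b &, injective x}, {in gtn w &, injective y} &
    forall i j, i < b -> j < w -> adj (x i) (y j) = p i j].

Definition contains (G : lbigraph) (b w : nat) (p : nat -> nat -> bool) :=
  exists x y : nat -> G, occurrence b w p x y.

(** An occurrence covering all vertices: the matrix then determines the labelled graph up to
    isomorphism. *)
Definition biadjacency (G : lbigraph) (b w : nat) (p : nat -> nat -> bool) :=
  exists x y : nat -> G, [/\ occurrence b w p x y,
    forall u, u \in black G -> exists2 i, i < b & x i = u &
    forall u, u \in white G -> exists2 j, j < w & y j = u].

Lemma biadjacency_contains G b w p : biadjacency G b w p -> contains G b w p.
Proof. by case=> x [y [xy _ _]]; exists x, y. Qed.

Lemma contains_seq (G : lbigraph) (xs ys : seq G) (m : seq (seq bool)) :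
    0 < size xs -> {subset xs <= black G} -> {subset ys <= white G} ->
    uniq xs -> uniq ys ->
    [seq [seq adj x y | x <- xs] | y <- ys] = m ->
  contains G (size xs) (size ys) (entry m).
Proof.
case: xs => // x0 xs _ xsB ysW uxs uys <-; set s := x0 :: xs in xsB uxs *.
exists (nth x0 s), (nth x0 ys); split.
- by move=> i /(mem_nth x0)/xsB.
- by move=> j /(mem_nth x0)/ysW.
- by move=> i j si sj /eqP; rewrite nth_uniq // => /eqP.
- by move=> i j si sj /eqP; rewrite nth_uniq // => /eqP.
- by move=> i j si sj; rewrite /entry (nth_map x0) // (nth_map x0).
Qed.

Lemma biadjacency_seq (G : lbigraph) (xs ys : seq G) (m : seq (seq bool)) :
    0 < size xs -> xs =i black G -> ys =i white G -> uniq xs -> uniq ys ->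
    [seq [seq adj x y | x <- xs] | y <- ys] = m ->
  biadjacency G (size xs) (size ys) (entry m).
Proof.
case: xs => // x0 xs _ xsB ysW; set s := x0 :: xs in xsB * => us uys <-.
exists (nth x0 s), (nth x0 ys); split.
- split.
  + by move=> i /(mem_nth x0); rewrite xsB.
  + by move=> j /(mem_nth x0); rewrite ysW.
  + by move=> i j si sj /eqP; rewrite nth_uniq // => /eqP.
  + by move=> i j si sj /eqP; rewrite nth_uniq // => /eqP.
  + by move=> i j si sj; rewrite /entry (nth_map x0) // (nth_map x0).
- by move=> u; rewrite -xsB => u_s; exists (index u s); rewrite ?index_mem ?nth_index.
- by move=> u; rewrite -ysW => u_s; exists (index u ys); rewrite ?index_mem ?nth_index.
Qed.

Lemma li_sub_contains H G b w p :
  li_sub H G -> contains H b w p -> contains G b w p.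
Proof.
case=> f [[finj fadj] fB fW] [x [y [xB yW xinj yinj xy]]].
exists (f \o x), (f \o y); split=> /=.
- by move=> i /xB/fB.
- by move=> j /yW/fW.
- by move=> i j ib jb /finj; apply: xinj.
- by move=> i j ib jb /finj; apply: yinj.
- by move=> i j ib jw; rewrite fadj xy.
Qed.

Lemma biadjacency_li_sub H G b w p :
  biadjacency H b w p -> contains G b w p -> li_sub H G.
Proof.
case=> [x [y [[xB yW _ _ xy] xs ys]]] [x' [y' [x'B y'W x'inj y'inj xy']]].
have Hbw := black_white H; have Gbw := black_white G.
have inW := bipartition_white Hbw; have inW' := bipartition_white Gbw.
pose P u v := if u \in black H then exists i, [/\ i < b, x i = u & v = x' i]
  else exists j, [/\ j < w, y j = u & v = y' j].
have exP u : exists v, P u v.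
  rewrite /P; have [uB|uB] := boolP (u \in black H).
    by have [i ib <-] := xs u uB; exists (x' i), i.
  by have [|j jw <-] := ys u; [rewrite inW | exists (y' j), j].
have [f fP] := choice exP.
have fB u : (f u \in black G) = (u \in black H).
  have := fP u; rewrite /P; case: ifP => _ [i [ib _ ->]]; first exact: x'B.
  by apply/negbTE; rewrite -inW'; apply: y'W.
exists f; split; last first.
- by move=> u; rewrite inW inW' fB.
- by move=> u; rewrite fB.
split=> [u v uv|u v].
  have := fB v; rewrite -uv fB => uB; move: (fP u) (fP v); rewrite /P uB uv.
  case: ifP => _ [i [ib <- ->]] [j [jb <- ij]].
    by rewrite (x'inj i j).
  by rewrite (y'inj i j).
have [uv|uv] := eqVneq (u \in black H) (v \in black H).
  have -> : adj u v = false.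
    by apply/negP => /(bipartition_adj Hbw); rewrite uv; case: (v \in _).
  by apply/negP => /(bipartition_adj Gbw); rewrite !fB uv; case: (v \in _).
wlog uB : u v uv / u \in black H.
  move=> H1; have [uB|uB] := boolP (u \in black H); first exact: H1.
  rewrite adj_sym [RHS]adj_sym; apply: H1; first by rewrite eq_sym.
  by move: uv; rewrite (negbTE uB); case: (v \in _).
move: uv (fP u) (fP v); rewrite /P uB; case: ifP => // _ _.
by case=> i [ib <- ->] [j [jw <- ->]]; rewrite xy // xy'.
Qed.

(** * Colourings that make all vertex subsets splittable *)

Section BipartiteP6.
Variables (G : sgraph) (B W : {set G}) (bw : bipartition B W) (d : bool).
Let L := LBigraph G B W bw.

(* The biadjacency matrix of P_6 for d = false, and that of its bipartite
   complement P_2 + P_4 for d = true. *)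
Definition mat_P6 (d : bool) :=
  [:: [:: ~~ d; ~~ d; d]; [:: d; ~~ d; ~~ d]; [:: d; d; ~~ d]].

Hypothesis free : ~ contains L 3 3 (entry (mat_P6 d)).

(** This is the adjacency of [G] or, when [d] holds, of its bipartite complement, which has the same
    splits. *)
Let e (u v : G) := ((u \in B) != (v \in B)) && (adj u v (+) d).

Lemma P6_pattern p1 p2 p3 p4 p5 p6 : p1 \in B ->
  e p1 p2 -> e p2 p3 -> e p3 p4 -> e p4 p5 -> e p5 p6 ->
  ~~ e p1 p4 -> ~~ e p2 p5 -> ~~ e p3 p6 -> ~~ e p1 p6 -> False.
Proof.
rewrite /e => B1; rewrite B1 /=; case B2 : (p2 \in B) => //=; case B3 : (p3 \in B) => //=.
case B4 : (p4 \in B) => //=; case B5 : (p5 \in B) => //=; case B6 : (p6 \in B) => //=.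
move=> e12 e23 e34 e45 e56 e14 e25 e36 e16; apply: free.
(* Vertices on the same side are distinct because some vertex of the other side sees only one of
   them. *)
have n13 : p1 != p3 by apply: contraNneq e14 => ->.
have n15 : p1 != p5 by apply: contraNneq e16 => ->.
have n35 : p3 != p5 by apply: contraNneq e36 => ->.
have n24 : p2 != p4 by apply: contraNneq e25 => ->.
have n26 : p2 != p6 by apply: contraNneq e16 => <-.
have n46 : p4 != p6 by apply: contraNneq e36 => <-.
have xP : [seq [seq adj x y | x <- [:: p1; p3; p5]] | y <- [:: p2; p4; p6]] = mat_P6 d.
  rewrite /mat_P6 /= [adj p3 p2]adj_sym [adj p5 p4]adj_sym [adj p5 p2]adj_sym.
  move: e12 e23 e34 e45 e56 e14 e25 e36 e16.
  by do 9! case: (adj _ _); case: (d).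
apply: (contains_seq (xs := [:: p1; p3; p5] : seq L)
  (ys := [:: p2; p4; p6] : seq L) _ _ _ _ _ xP) => //.
- by move=> u; rewrite !inE => /or3P[] /eqP->; rewrite //= ?B3 ?B5.
- move=> u; rewrite !inE /= (bipartition_white bw).
  by case/or3P => /eqP->; rewrite ?B2 ?B4 ?B6.
- by rewrite /= !inE negb_or n13 n15 n35.
- by rewrite /= !inE negb_or n24 n26 n46.
Qed.

Let e_sym : symmetric e.
Proof. by move=> u v; rewrite /e eq_sym adj_sym. Qed.

Let e_col u v : e u v -> (v \in B) = ~~ (u \in B).
Proof. by rewrite /e => /andP[]; case: (u \in B); case: (v \in B). Qed.

Let noP6 p1 p2 p3 p4 p5 p6 :
  e p1 p2 -> e p2 p3 -> e p3 p4 -> e p4 p5 -> e p5 p6 ->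
  ~~ e p1 p4 -> ~~ e p2 p5 -> ~~ e p3 p6 -> ~~ e p1 p6 -> False.
Proof.
move=> e12 e23 e34 e45 e56 e14 e25 e36 e16.
have [p1B|p1B] := boolP (p1 \in B); first exact: (@P6_pattern p1 p2 p3 p4 p5 p6).
have p6B : p6 \in B.
  by rewrite (e_col e56) (e_col e45) (e_col e34) (e_col e23) (e_col e12) (negbTE p1B).
by apply: (P6_pattern p6B) => //; rewrite e_sym; [exact: e56|exact: e45|exact: e34
  |exact: e23|exact: e12|exact: e36|exact: e25|exact: e14|exact: e16].
Qed.

Let col (u : G) : 'I_2 := if u \in B then ord0 else ord_max.

Let colE u : (col u == ord0) = (u \in B).
Proof. by rewrite /col; case: ifP. Qed.

Lemma P6_splittable (U : {set G}) : 1 < #|U| -> splittable col U.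
Proof.
move=> U1; pose V := {u | u \in U}.
have V1 : 1 < #|{: V}| by rewrite card_sig.
have [|||S [S0 ST] [q qE]] :=
  @P6free_splits V (fun u => val u \in B) (fun u v => e (val u) (val v)) _ _ _ V1.
- by move=> u v; exact: e_sym.
- by move=> u v; exact: e_col.
- by move=> p1 p2 p3 p4 p5 p6; exact: noP6.
have inS (u : V) : (val u \in val @: S) = (u \in S) by rewrite mem_imset //; exact: val_inj.
exists (val @: S); split.
- by apply/subsetP => _ /imsetP[u _ ->]; exact: valP.
- by case/set0Pn: S0 => u uS; apply/set0Pn; exists (val u); rewrite inS.
- have : exists u, u \notin S.
    apply: contrapT => H; case/negP: ST; apply/eqP/setP => u; rewrite inE.
    by apply/negPn/negP => uS; apply: H; exists u.
  by case=> u uS; apply/set0Pn; exists (val u); rewrite inE inS uS; exact: valP.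
(* Vertices of the same colour are not adjacent; for the others, adding [d] undoes the bipartite
   complement. *)
exists (fun c c' => ((c == ord0) != (c' == ord0)) && (q (c == ord0) (+) d)).
move=> _ v /imsetP[u uS ->]; rewrite inE => /andP[vS vU]; rewrite !colE.
have [uv|uv] := eqVneq (val u \in B) (v \in B).
  by apply/negP => /(bipartition_adj bw); rewrite uv; case: (v \in B).
pose v' : V := exist _ v vU; have v'S : v' \notin S by rewrite -inS.
rewrite -(qE u v') // /e /=; first by rewrite uv -addbA addbb addbF.
by move: uv; case: (val u \in B); case: (v \in B).
Qed.

Lemma P6_cliquewidth : cliquewidth G <= 4.
Proof. exact: splittable_cliquewidth P6_splittable. Qed.
End BipartiteP6.

Section Laminar.
Variables (G : sgraph) (B W : {set G}) (bw : bipartition B W) (fl : pred G).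
(** The neighbourhood of a white [w], complemented in [B] when the flag [fl w] is set. *)
Let N w := [set b in B | adj w b != fl w].
Hypothesis laminar : forall w1 w2, w1 \in W -> w2 \in W ->
  [|| [disjoint N w1 & N w2], N w1 \subset N w2 | N w2 \subset N w1].

Let col (u : G) : 'I_3 :=
  if u \in B then ord0 else if fl u then ord_max else @Ordinal 3 1 isT.
(** The adjacency between a white [w] and a black vertex outside [N w]: it holds exactly when [w] is
    flagged. *)
Let q (c c' : 'I_3) :=
  ((c == 0 :> nat) && (c' == 2 :> nat)) || ((c == 2 :> nat) && (c' == 0 :> nat)).

Let inW u : (u \in W) = ~~ (u \in B).
Proof. exact: bipartition_white. Qed.

Let same u v : (u \in B) = (v \in B) -> adj u v = false.
Proof. by move=> uv; apply/negP => /(bipartition_adj bw); rewrite uv; case: (v \in B). Qed.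

Let qE u v : (v \in W -> u \notin N v) -> (u \in W -> v \notin N u) ->
  adj u v = q (col u) (col v).
Proof.
rewrite !inE !inW /q /col /= => uv vu.
case uB : (u \in B) uv vu; case vB : (v \in B) => /= uv vu.
- by rewrite same ?uB ?vB.
- by move/negPn/eqP: (uv isT); rewrite adj_sym => ->; case: (fl v).
- by move/negPn/eqP: (vu isT) => ->; case: (fl u).
- by rewrite same ?uB ?vB //; case: (fl u); case: (fl v).
Qed.

(** For a white [w] in [U] with [N w :&: U] largest, [S] consists of the black vertices in [N w] and
    the white ones whose set lies inside [N w]. By laminarity and maximality the set of any other
    white vertex is disjoint from [N w], or else would have to lie inside it; so pairs across [S]
    follow [q]. If [S] is all of [U], then [w] splits off alone. *)
Lemma laminar_splittable (U : {set G}) : 1 < #|U| -> splittable col U.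
Proof.
move=> U1; have U0 : U != set0 by rewrite -card_gt0; apply: leq_trans U1.
have single u (r : 'I_3 -> bool) : u \in U ->
    (forall v, v \in U -> v != u -> adj u v = r (col v)) -> splittable col U.
  move=> uU H; exists [set u]; split.
  - by rewrite sub1set.
  - by apply/set0Pn; exists u; rewrite inE.
  - by rewrite -card_gt0 cardsD (setIidPr _) ?sub1set // cards1 subn_gt0.
  - by exists (fun _ => r) => _ v /set1P-> ; rewrite !inE => /andP[vu vU]; exact: H.
have [noW|] := boolP [forall w in U, w \notin W].
  case/set0Pn: U0 => u uU; apply: (single u (q (col u))) => // v vU _.
  by apply: qE => [vW|uW]; [have := forall_inP noW v vU | have := forall_inP noW u uU];
    rewrite ?vW ?uW.
rewrite negb_forall_in => /exists_inP[w0 w0U]; rewrite negbK => w0W.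
have w0P : (w0 \in U) && (w0 \in W) by rewrite w0U.
have [w /andP[wU wW] wmax] :=
  @arg_maxnP _ w0 (fun w => (w \in U) && (w \in W)) (fun w => #|N w :&: U|) w0P.
pose S := [set u in U | if u \in B then u \in N w else N u :&: U \subset N w].
have inS u : (u \in S) = (u \in U) && if u \in B then u \in N w else N u :&: U \subset N w.
  by rewrite inE.
have wB : w \notin B by rewrite -inW.
have [SU|SU] := eqVneq S U.
  apply: (single w (fun c => (c == ord0) && ~~ fl w)) => // v; rewrite -{1}SU inE.
  case/andP=> vU vS _; move: vS; rewrite /col; case: ifPn => vB.
    by rewrite inE vB /=; case: (adj w v); case: (fl w).
  by move=> _; rewrite same ?(negbTE wB) ?(negbTE vB) //; case: (fl v).
exists S; split.
- by apply/subsetP => u; rewrite inE => /andP[].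
- by apply/set0Pn; exists w; rewrite inE wU (negbTE wB) subsetIl.
- have SsubU : S \subset U by apply/subsetP => u; rewrite inE => /andP[].
  by rewrite setD_eq0; apply: contra SU => US; rewrite eqEsubset SsubU.
exists q => u v; rewrite inS => /andP[uU uS]; rewrite in_setD inS.
case/andP=> vS vU; rewrite vU /= in vS; apply: qE => [vW|uW].
  apply/negP => uNv; have uB : u \in B by move: uNv; rewrite inE => /andP[].
  have vB : v \notin B by rewrite -inW.
  rewrite uB in uS; rewrite (negbTE vB) in vS.
  case/or3P: (laminar wW vW) => [dis|wv|vw].
  - by have := disjointFr dis uS; rewrite uNv.
  - have := wmax v; rewrite vU vW => /(_ isT); rewrite /= leqNgt => /negP; apply.
    apply: proper_card; rewrite properE setSI //=.
    apply: contra vS => /subset_trans; apply; exact: subsetIl.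
  - by case/negP: vS; apply: subset_trans vw; exact: subsetIl.
apply/negP => vNu; have vB : v \in B by move: vNu; rewrite inE => /andP[].
rewrite inW in uW; rewrite (negbTE uW) in uS; rewrite vB in vS.
by case/negP: vS; apply: (subsetP uS); rewrite in_setI vNu.
Qed.

Lemma laminar_cliquewidth : cliquewidth G <= 6.
Proof. exact: splittable_cliquewidth laminar_splittable. Qed.
End Laminar.

Section FewBlack.
Variables (G : sgraph) (B W : {set G}) (bw : bipartition B W).

Lemma few_black_cliquewidth : cliquewidth G <= #|B|.+1 + #|B|.+1.
Proof.
(* Each black vertex gets a colour of its own below [#|B|]; as [index] of an absent element is the
   size, all white vertices share the colour [#|B|]. *)
pose col (u : G) : 'I_#|B|.+1 := inord (index u (enum B)).
have colB u v : u \in B -> col u = col v -> u = v.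
  move=> uB /(congr1 val); rewrite /= !inordK ?ltnS ?cardE ?index_size //.
  move=> uv; have uB' : u \in enum B by rewrite mem_enum.
  have vB' : v \in enum B by rewrite -index_mem -uv index_mem.
  by rewrite -(nth_index u uB') uv nth_index.
apply: (splittable_cliquewidth (col := col)) => U U1.
(* A white vertex is split off if possible: its neighbours are black, hence identified by their
   colours. *)
have [u uU uB] : exists2 u, u \in U & forall w, w \notin B -> w \in U -> u \notin B.
  have [/exists_inP[u uU uB]|noW] := boolP [exists u in U, u \notin B].
    by exists u.
  have /card_gt0P[u uU] : 0 < #|U| by apply: leq_trans U1.
  exists u => // w wB wU; case/exists_inP: noW; by exists w.
exists [set u]; split.
- by rewrite sub1set.
- by apply/set0Pn; exists u; rewrite inE.
- by rewrite -card_gt0 cardsD (setIidPr _) ?sub1set // cards1 subn_gt0.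
exists (fun _ c => [exists v in B, (col v == c) && adj u v]).
move=> _ v /set1P->; rewrite !inE => /andP[vu vU].
apply/idP/exists_inP => [uv|[v' v'B /andP[/eqP vv' uv']]]; last by rewrite -(colB v' v).
exists v; last by rewrite eqxx.
apply/negPn/negP => vB; have := uB v vB vU; have := bipartition_adj bw uv.
by rewrite (negbTE vB); case: (u \in B).
Qed.
End FewBlack.

(** * Boundedness for the maximal forbidden graphs *)

Lemma weakly_free_contains T b w p G : biadjacency T b w p -> weakly_free T G ->
  exists B W (bw : bipartition B W), ~ contains (LBigraph G B W bw) b w p.
Proof.
by move=> bT [B [W [bw TG]]]; exists B, W, bw => /(biadjacency_li_sub bT).
Qed.

Lemma li_sub_trans H1 H2 H3 : li_sub H1 H2 -> li_sub H2 H3 -> li_sub H1 H3.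
Proof.
move=> [f [[finj fadj] fB fW]] [g [[ginj gadj] gB gW]].
exists (g \o f); split; first by split=> [|x y]; [exact: inj_comp | rewrite /= gadj].
  by move=> x /fB/gB.
by move=> x /fW/gW.
Qed.

Lemma weakly_free_sub H1 H2 G : li_sub H1 H2 -> weakly_free H1 G -> weakly_free H2 G.
Proof.
move=> H12 [B [W [bw HG]]]; exists B, W, bw => H2G; exact: HG (li_sub_trans H12 H2G).
Qed.

Lemma bounded_sub H1 H2 : li_sub H1 H2 ->
  bounded_cliquewidth (weakly_free H2) -> bounded_cliquewidth (weakly_free H1).
Proof. by move=> H12 [c cP]; exists c => G /(weakly_free_sub H12)/cP. Qed.

Lemma weakly_free_opposite H G : weakly_free (opposite H) G -> weakly_free H G.
Proof.
case=> B [W [bw HG]]; exists W, B, (bipartition_swap bw) => -[f [fe fB fW]].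
by apply: HG; exists f; split.
Qed.

Lemma bounded_opposite H :
  bounded_cliquewidth (weakly_free H) -> bounded_cliquewidth (weakly_free (opposite H)).
Proof. by case=> c cP; exists c => G /weakly_free_opposite/cP. Qed.

Lemma biadjacency_P6_b : biadjacency (P_b 6) 3 3 (entry (mat_P6 false)).
Proof.
pose o i (lt_i6 : i < 6) : P_b 6 := Ordinal lt_i6.
apply: (@biadjacency_seq (P_b 6) [:: @o 0 isT; @o 2 isT; @o 4 isT]
  [:: @o 1 isT; @o 3 isT; @o 5 isT]) => //.
- by case=> [[|[|[|[|[|[|x]]]]]] lt_x6]; rewrite //= !inE -!val_eqE.
- by case=> [[|[|[|[|[|[|x]]]]]] lt_x6]; rewrite //= !inE -!val_eqE.
Qed.

Definition P2_P4_b := lunion (P_b 2) (P_b 4).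

Lemma biadjacency_P2_P4_b : biadjacency P2_P4_b 3 3 (entry (mat_P6 true)).
Proof.
pose o i (lt_i : i < 2) : P2_P4_b := inl (Ordinal lt_i).
pose o' i (lt_i : i < 4) : P2_P4_b := inr (Ordinal lt_i).
apply: (@biadjacency_seq P2_P4_b [:: @o' 2 isT; @o' 0 isT; @o 0 isT]
  [:: @o 1 isT; @o' 3 isT; @o' 1 isT]) => //.
- by case=> -[[|[|[|[|x]]]] lt_x]; rewrite //= !inE.
- by case=> -[[|[|[|[|x]]]] lt_x]; rewrite //= !inE.
Qed.

Lemma biadjacency_twoP1_P3_b :
  biadjacency twoP1_P3_b 4 1 (entry [:: [:: false; false; true; true]]).
Proof.
pose o i (lt_i : i < 2) : twoP1_P3_b := inl (Ordinal lt_i).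
pose o' i (lt_i : i < 3) : twoP1_P3_b := inr (Ordinal lt_i).
apply: (@biadjacency_seq twoP1_P3_b [:: @o 0 isT; @o 1 isT; @o' 0 isT; @o' 2 isT]
  [:: @o' 1 isT]) => //.
- by case=> -[[|[|[|x]]] lt_x]; rewrite //= !inE.
- by case=> -[[|[|[|x]]] lt_x]; rewrite //= !inE.
Qed.

Lemma biadjacency_P1_P5_b : biadjacency P1_P5_b 4 2
  (entry [:: [:: false; true; true; false]; [:: false; false; true; true]]).
Proof.
pose o i (lt_i : i < 1) : P1_P5_b := inl (Ordinal lt_i).
pose o' i (lt_i : i < 5) : P1_P5_b := inr (Ordinal lt_i).
apply: (@biadjacency_seq P1_P5_b [:: @o 0 isT; @o' 0 isT; @o' 2 isT; @o' 4 isT]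
  [:: @o' 1 isT; @o' 3 isT]) => //.
- by case=> -[[|[|[|[|[|x]]]]] lt_x]; rewrite //= !inE.
- by case=> -[[|[|[|[|[|x]]]]] lt_x]; rewrite //= !inE.
Qed.

Lemma bounded_P6_b : bounded_cliquewidth (weakly_free (P_b 6)).
Proof.
exists 4 => G /(weakly_free_contains biadjacency_P6_b)[B [W [bw]]].
exact: P6_cliquewidth.
Qed.

Lemma bounded_P2_P4_b : bounded_cliquewidth (weakly_free P2_P4_b).
Proof.
exists 4 => G /(weakly_free_contains biadjacency_P2_P4_b)[B [W [bw]]].
exact: P6_cliquewidth.
Qed.

(** No white vertex has both two black neighbours and two black non-neighbours. Flagging those with
    at least two neighbours leaves sets of size at most 1, which are laminar. *)
Lemma bounded_twoP1_P3_b : bounded_cliquewidth (weakly_free twoP1_P3_b).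
Proof.
exists 6 => G /(weakly_free_contains biadjacency_twoP1_P3_b)[B [W [bw free]]].
pose nbr w := [set b in B | adj w b].
pose fl w := 1 < #|nbr w|.
apply: (laminar_cliquewidth bw (fl := fl)) => w1 w2 w1W w2W.
have card1 w : w \in W -> #|[set b in B | adj w b != fl w]| <= 1.
  move=> wW; rewrite leqNgt; apply/negP => /card_gt1P[z1 [z2 []]].
  rewrite !inE => /andP[z1B wz1] /andP[z2B wz2] z12.
  case flw : (fl w) wz1 wz2 => wz1 wz2; last first.
    move/negbT: flw => /negP; apply; apply/card_gt1P; exists z1, z2.
    by rewrite !inE z1B z2B; move: wz1 wz2; case: (adj w z1); case: (adj w z2).
  have /card_gt1P[y1 [y2 []]] := flw.
  rewrite !inE => /andP[y1B wy1] /andP[y2B wy2] y12.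
  move: wz1 wz2; rewrite !eqb_id => wz1 wz2.
  apply: free; apply: (@contains_seq (LBigraph G B W bw) [:: z1; z2; y1; y2] [:: w]) => //.
  - by move=> u; rewrite !inE => /or4P[] /eqP->.
  - by move=> u; rewrite !inE => /eqP->.
  - rewrite /= !inE !negb_or z12 y12 !andbT /=.
    by apply/andP; split; apply/andP; split; [apply: contraNneq wz1|apply: contraNneq wz1
      |apply: contraNneq wz2|apply: contraNneq wz2] => ->.
  - by rewrite /= ![adj _ w]adj_sym (negbTE wz1) (negbTE wz2) wy1 wy2.
have [dis|] := boolP [disjoint [set b in B | adj w1 b != fl w1]
  & [set b in B | adj w2 b != fl w2]] => //=.
rewrite -setI_eq0 => /set0Pn[b /setIP[b1 b2]].
apply/orP; left; apply/subsetP => b' b'1.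
by have -> : b' = b by apply: (card_le1_eqP (card1 _ w1W)).
Qed.

(** Freeness forbids two white neighbourhoods for which all four regions of [B] are nonempty. Flags
    chosen by a fixed black [b0] keep [b0] outside every set, so two crossing sets would leave no
    region empty; complementing only permutes the regions. *)
Lemma bounded_P1_P5_b : bounded_cliquewidth (weakly_free P1_P5_b).
Proof.
exists 6 => G /(weakly_free_contains biadjacency_P1_P5_b)[B [W [bw free]]].
(* The digits tell whether the vertex is seen by [w1] and by [w2]. *)
have crossing w1 w2 b00 b10 b11 b01 : w1 \in W -> w2 \in W ->
    [&& b00 \in B, b10 \in B, b11 \in B & b01 \in B] ->
    [/\ ~~ adj w1 b00, adj w1 b10, adj w1 b11 & ~~ adj w1 b01] ->
    [/\ ~~ adj w2 b00, ~~ adj w2 b10, adj w2 b11 & adj w2 b01] -> False.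
  move=> w1W w2W /and4P[B00 B10 B11 B01] [a00 a10 a11 a01] [b00' b10' b11' b01'].
  apply: free; apply: (@contains_seq (LBigraph G B W bw)
    [:: b00; b10; b11; b01] [:: w1; w2]) => //.
  - by move=> u; rewrite !inE => /or4P[] /eqP->.
  - by move=> u; rewrite !inE => /orP[] /eqP->.
  - rewrite /= !inE !negb_or andbT; apply/and3P; split.
    + by apply/and3P; split; [apply: contraNneq a00|apply: contraNneq a00
        |apply: contraNneq b00'] => ->.
    + by apply/andP; split; apply: contraNneq b10' => ->.
    + by apply: contraNneq a01 => <-.
  - by rewrite /= andbT inE; apply: contraNneq b10' => <-.
  - rewrite /= ![adj _ w1]adj_sym ![adj _ w2]adj_sym a10 a11 b11' b01'.
    by rewrite (negbTE a00) (negbTE a01) (negbTE b00') (negbTE b10').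
have [B0|/set0Pn[b0 b0B]] := eqVneq B set0.
  apply: (laminar_cliquewidth bw (fl := pred0)) => w1 w2 _ _.
  by rewrite -setI_eq0 setI_eq0 disjoint_subset; apply/orP; left;
    apply/subsetP => b; rewrite !inE B0 inE.
apply: (laminar_cliquewidth bw (fl := fun w => adj w b0)) => w1 w2 w1W w2W.
set N1 := [set b in B | adj w1 b != adj w1 b0].
set N2 := [set b in B | adj w2 b != adj w2 b0].
case: (boolP [disjoint N1 & N2]) => //=; rewrite -setI_eq0 => /set0Pn[b2].
rewrite !inE => /andP[/andP[b2B b12] /andP[_ b22]].
apply: contraT; rewrite negb_or => /andP[/subsetPn[b1 + b1N] /subsetPn[b3 + b3N]].
rewrite !inE => /andP[b1B b11] /andP[b3B b23].
move: b1N b3N; rewrite !inE b1B b3B /= !negbK => /eqP b21 /eqP b13.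
exfalso; move: b11 b12 b22 b23.
case f1 : (adj w1 b0) b13; case f2 : (adj w2 b0) b21 => b21 b13;
  rewrite ?eqb_id ?eqbF_neg ?negbK => b11 b12 b22 b23.
- by apply: (crossing w1 w2 b2 b3 b0 b1) => //; rewrite ?b0B ?b1B ?b2B ?b3B //;
  split; rewrite ?f1 ?f2 ?b13 ?b21.
- by apply: (crossing w1 w2 b1 b0 b3 b2) => //; rewrite ?b0B ?b1B ?b2B ?b3B //;
  split; rewrite ?f1 ?f2 ?b13 ?b21.
- by apply: (crossing w1 w2 b3 b2 b1 b0) => //; rewrite ?b0B ?b1B ?b2B ?b3B //;
  split; rewrite ?f1 ?f2 ?b13 ?b21.
- by apply: (crossing w1 w2 b0 b1 b2 b3) => //; rewrite ?b0B ?b1B ?b2B ?b3B //;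
  split; rewrite ?f1 ?f2 ?b13 ?b21.
Qed.

Lemma bounded_sP1_b s : bounded_cliquewidth (weakly_free (sP1_b s)).
Proof.
exists (s + s) => G [B [W [bw free]]].
have [lt_Bs|le_sB] := ltnP #|B| s.
  by apply: leq_trans (few_black_cliquewidth bw) _; apply: leq_add.
case: free; pose f (i : sP1 s) : G := enum_val (widen_ord le_sB i).
exists f; split; last by move=> x; rewrite inE.
  split=> [i j /enum_val_inj/(congr1 val)/= /val_inj //|i j].
  rewrite [RHS]/= /edgeless_adj; apply/negP => /(bipartition_adj bw).
  by rewrite !enum_valP.
by move=> i _; apply: enum_valP.
Qed.

(** * A lower bound on the clique-width of grid-like graphs *)

Section Context.
Variables (G : sgraph) (k : nat).

(* t is a subterm of a term constructing G, and h the inclusion of its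
   vertices: the operations above t only see the labels of t. *)
Definition subterm_of (t : cwterm k) (h : cweval t -> G) : Prop :=
  [/\ injective h,
    exists F : rel 'I_k, forall x y, x != y ->
      adj (h x) (h y) = adj x y || F (lab x) (lab y) &
    forall x y z, z \notin codom h -> lab x = lab y -> adj (h x) z = adj (h y) z].

Lemma subterm_join i j (ij : i != j) (t : cwterm k)
    (h : cweval (CwJoin ij t) -> G) : subterm_of h -> @subterm_of t h.
Proof.
case=> hinj [F FE] out; split=> //.
exists (fun a b => [|| (a == i) && (b == j), (a == j) && (b == i) | F a b]) => x y xy.
by rewrite (FE x y xy) /= /kjoin_adj !orbA.
Qed.

Lemma subterm_relabel i j (t : cwterm k)
    (h : cweval (CwRelabel i j t) -> G) : subterm_of h -> @subterm_of t h.
Proof.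
case=> hinj [F FE] out; pose r (a : 'I_k) := if a == i then j else a.
split=> //; first by exists (fun a b => F (r a) (r b)) => x y xy; rewrite (FE x y xy).
by move=> x y z zh xy; apply: out => //=; rewrite xy.
Qed.

Lemma subterm_unionl t1 t2 (h : cweval (CwUnion t1 t2) -> G) :
  subterm_of h -> @subterm_of t1 (h \o inl).
Proof.
case=> hinj [F FE] out; split=> [|| x y z zh xy /=].
- by apply: inj_comp => // x y [].
- by exists F => x y xy; rewrite /= FE.
have [/codomP[[z1 zz|z2 ->]]|zh'] := boolP (z \in codom h); last exact: out.
  by case/negP: zh; apply/codomP; exists z1.
by rewrite !FE //= xy.
Qed.

Lemma subterm_unionr t1 t2 (h : cweval (CwUnion t1 t2) -> G) :
  subterm_of h -> @subterm_of t2 (h \o inr).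
Proof.
case=> hinj [F FE] out; split=> [|| x y z zh xy /=].
- by apply: inj_comp => // x y [].
- by exists F => x y xy; rewrite /= FE.
have [/codomP[[z1 ->|z2 zz]]|zh'] := boolP (z \in codom h); last exact: out.
  by rewrite !FE //= xy.
by case/negP: zh; apply/codomP; exists z2.
Qed.

Definition few_types (X : {set G}) := exists l : G -> 'I_k, forall x y z,
  x \in X -> y \in X -> z \notin X -> l x = l y -> adj x z = adj y z.

Lemma subterm_few_types t (h : cweval t -> G) :
  subterm_of h -> few_types [set x | x \in codom h].
Proof.
(* Terms build nonempty graphs, so [x0] provides a default label. *)
case=> hinj _ out; have x0 : cweval t.
  elim: (t) => [i|t1 x1 t2 _|i j ij t1 x1|i j t1 x1] //=; [exact: ord0 | by left].
exists (fun g => lab (odflt x0 [pick x | h x == g])) => x y z; rewrite !inE.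
move=> /codomP[x' ->] /codomP[y' ->] zh.
case: pickP => [x'' /eqP/hinj->|/(_ x')]; last by rewrite eqxx.
case: pickP => [y'' /eqP/hinj->|/(_ y')]; last by rewrite eqxx.
exact: out.
Qed.

End Context.

(** The 2 by 2 principal submatrices of [r] have neither equal rows nor equal columns. *)
Definition separating (n : nat) (r : rel 'I_n) := forall i j, i != j ->
  ~ (r i i = r j i /\ r i j = r j j) /\ ~ (r i i = r i j /\ r j i = r j j).

(** The vertices [v j] inside [X] have different types because the [y j] distinguish them; for the
    [v j] outside [X], they distinguish the corresponding [a j]. Each kind of index occurs at most
    [k] times. *)
Lemma few_types_mixed (G : sgraph) k n (r : rel 'I_n) (X : {set G})
    (J : {set 'I_n}) (v a y : 'I_n -> G) :
  separating r -> few_types k X ->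
  (forall j, j \in J -> [/\ a j \in X, y j \notin X &
    forall i, adj (v i) (a j) = r j i /\ adj (v i) (y j) = r j i]) ->
  #|J| <= k + k.
Proof.
move=> sep [l lX] JP.
have bound (J' : {set 'I_n}) (f : 'I_n -> G) : {in J' &, injective (l \o f)} -> #|J'| <= k.
  by move=> finj; rewrite -(card_in_imset finj) -[k in _ <= k]card_ord max_card.
rewrite -(cardsID [set j | v j \in X]); apply: leq_add.
  apply: (bound _ v) => i j; rewrite !inE => /andP[iJ vi] /andP[jJ vj] /= lij.
  apply/eqP/negPn/negP => ij; have [_ H] := sep i j ij; apply: H.
  have [_ yi iE] := JP i iJ; have [_ yj jE] := JP j jJ.
  have := lX _ _ _ vi vj yj lij; have := lX _ _ _ vi vj yi lij.
  by rewrite !(iE _).2 !(jE _).2.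
apply: (bound _ a) => i j; rewrite !inE => /andP[vi iJ] /andP[vj jJ] /= lij.
apply/eqP/negPn/negP => ij; have [H _] := sep i j ij; apply: H.
have [ai _ iE] := JP i iJ; have [aj _ jE] := JP j jJ.
have := lX _ _ _ ai aj vj lij; have := lX _ _ _ ai aj vi lij.
by rewrite ![adj (a _) _]adj_sym !(iE _).1 !(jE _).1.
Qed.

Section Grid.
Variables (n : nat) (r s : rel 'I_n).

Definition grid_vertex : finType := (('I_n * 'I_n) + ('I_n + 'I_n))%type.

Definition incident (c : 'I_n * 'I_n) (l : 'I_n + 'I_n) :=
  match l with inl i => r c.1 i | inr j => s c.2 j end.

Definition grid_adj (u v : grid_vertex) :=
  match u, v with
  | inl c, inr l => incident c l
  | inr l, inl c => incident c l
  | _, _ => false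
  end.

Lemma grid_adj_sym : symmetric grid_adj. Proof. by case=> c [] d. Qed.
Lemma grid_adj_irr : irreflexive grid_adj. Proof. by case. Qed.
Definition grid := SGraph grid_vertex grid_adj grid_adj_sym grid_adj_irr.

Definition cells : {set grid} := [set u : grid_vertex | if u is inl _ then true else false].
Definition lines : {set grid} := [set u : grid_vertex | if u is inl _ then false else true].

Lemma grid_bipartition : bipartition lines cells.
Proof.
apply/and4P; split.
- by apply/eqP/setP => -[] u; rewrite !inE.
- by rewrite -setI_eq0; apply/eqP/setP => -[] u; rewrite !inE.
- by apply/'forall_implyP => -[] u; rewrite inE // => _;
    apply/'forall_implyP => -[] v; rewrite inE.
- by apply/'forall_implyP => -[] u; rewrite inE // => _;
    apply/'forall_implyP => -[] v; rewrite inE.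
Qed.

Hypotheses (sep_r : separating r) (sep_s : separating s).

Definition full_line (X : {set grid}) :=
  [exists i, [forall j, (inl (i, j) : grid) \in X]] ||
  [exists j, [forall i, (inl (i, j) : grid) \in X]].

(** A column meeting [X] in row [i0] also has a cell outside [X], as no column is full, so
    [few_types_mixed] applies to the column vertices. *)
Lemma row_cells k (X : {set grid}) i0 : few_types k X -> ~~ full_line X ->
  #|[set j | (inl (i0, j) : grid) \in X]| <= k + k.
Proof.
move=> kX; rewrite negb_or => /andP[_ /existsPn colX].
pose y j : grid :=
  if [pick i | inl (i, j) \notin X] is Some i then inl (i, j) else inl (i0, j).
refine (@few_types_mixed grid k n s X _ (fun i => inr (inr i))
  (fun j => inl (i0, j)) y sep_s kX _) => j; rewrite inE => jX.
rewrite /y; case: pickP => [i iX|noX]; first by split.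
by case/negP: (colX j); apply/forallP => i; apply/negPn/negP; rewrite noX.
Qed.

Lemma col_cells k (X : {set grid}) j0 : few_types k X -> ~~ full_line X ->
  #|[set i | (inl (i, j0) : grid) \in X]| <= k + k.
Proof.
move=> kX; rewrite negb_or => /andP[/existsPn rowX _].
pose y i : grid :=
  if [pick j | inl (i, j) \notin X] is Some j then inl (i, j) else inl (i, j0).
refine (@few_types_mixed grid k n r X _ (fun i => inr (inl i))
  (fun i => inl (i, j0)) y sep_r kX _) => i; rewrite inE => iX.
rewrite /y; case: pickP => [j jX|noX]; first by split.
by case/negP: (rowX i); apply/forallP => j; apply/negPn/negP; rewrite noX.
Qed.

(** The induction descends to a single vertex, where [n] is at most 1, or to a union with a full
    line whose arguments have none and thus hold at most [k + k] cells of that line each. *)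
Lemma subterm_full_line k (t : cwterm k) (h : cweval t -> grid) :
  subterm_of h -> full_line [set x | x \in codom h] -> n <= 4 * k.
Proof.
elim: t h => [i|t1 IH1 t2 IH2|i j ij t1 IH|i j t1 IH] h hP.
- have k0 : 0 < k by case: (i) => m; case: (k).
  have one c d : (inl c : grid) \in [set x | x \in codom h] ->
      (inl d : grid) \in [set x | x \in codom h] -> c = d.
    by rewrite !inE => /codomP[x xE] /codomP[y]; rewrite (ord1 y) -(ord1 x) -xE => -[->].
  move=> full; suff le_n1 : n <= 1 by apply: leq_trans le_n1 _; rewrite muln_gt0.
  rewrite leqNgt; case/orP: full => /existsP[l /forallP lX]; apply/negP => n1.
    have := one _ _ (lX (Ordinal n1)) (lX (Ordinal (ltnW n1))).
    by move/(congr1 snd)/(congr1 val).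
  have := one _ _ (lX (Ordinal n1)) (lX (Ordinal (ltnW n1))).
  by move/(congr1 fst)/(congr1 val).
- set X := [set x | x \in codom h].
  pose X1 := [set x : grid | x \in codom (h \o inl)].
  pose X2 := [set x : grid | x \in codom (h \o inr)].
  have hl := subterm_unionl hP; have hr := subterm_unionr hP.
  have [f1|f1] := boolP (full_line X1); first by move=> _; apply: IH1 f1.
  have [f2|f2] := boolP (full_line X2); first by move=> _; apply: IH2 f2.
  have k1 := subterm_few_types hl; have k2 := subterm_few_types hr.
  have XE u : u \in X -> (u \in X1) || (u \in X2).
    by rewrite !inE => /codomP[[x|x] ->]; apply/orP; [left|right]; apply/codomP; exists x.
  have -> : 4 * k = (k + k) + (k + k) by rewrite !addnn -!mul2n mulnA.
  rewrite -{1}(card_ord n) -cardsT.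
  case/orP => /existsP[l /forallP lX].
    apply: leq_trans (leq_add (row_cells l k1 f1) (row_cells l k2 f2)).
    apply: leq_trans (leq_card_setU _ _); apply: subset_leq_card.
    by apply/subsetP => i _; rewrite inE [X in X || _]inE [X in _ || X]inE XE.
  apply: leq_trans (leq_add (col_cells l k1 f1) (col_cells l k2 f2)).
  apply: leq_trans (leq_card_setU _ _); apply: subset_leq_card.
  by apply/subsetP => i _; rewrite inE [X in X || _]inE [X in _ || X]inE XE.
- by apply: IH; exact: subterm_join hP.
- by apply: IH; exact: subterm_relabel hP.
Qed.

Lemma grid_constructible k : constructible k grid -> n <= 4 * k.
Proof.
case=> [|[t [f [[h fK hK] fadj]]]].
  rewrite card_sum !card_prod card_ord => /eqP; rewrite addn_eq0 muln_eq0 orbb.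
  by case/andP => /eqP->.
have [->//|n0] := posnP n.
apply: (@subterm_full_line k t h).
  split.
  - exact: can_inj hK.
  - by exists (fun _ _ => false) => x y _; rewrite orbF -fadj !hK.
  - by move=> x y z; case/negP; apply/codomP; exists (f z); rewrite fK.
apply/orP; left; apply/existsP; exists (Ordinal n0); apply/forallP => j.
by rewrite inE; apply/codomP; exists (f (inl (Ordinal n0, j))); rewrite fK.
Qed.
End Grid.

(** * Patterns avoided by grid-like graphs *)

Lemma unbounded_grids (H : lbigraph) :
  (forall n, exists r s : rel 'I_n,
    [/\ separating r, separating s & weakly_free H (grid r s)]) ->
  ~ bounded_cliquewidth (weakly_free H).
Proof.
move=> HG [c cP]; have [r [s [sr ss /cP]]] := HG (4 * c).+1.
rewrite /cliquewidth; case: ex_minnP => k /asboolP kP _ kc.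
have := grid_constructible sr ss kP.
by rewrite leqNgt ltnS leq_mul.
Qed.

Definition lgrid n (r s : rel 'I_n) :=
  LBigraph (grid r s) (lines r s) (cells r s) (grid_bipartition r s).

Definition transpose (p : nat -> nat -> bool) i j := p j i.

Lemma contains_opposite H b w p :
  contains (opposite H) b w p -> contains H w b (transpose p).
Proof.
case=> x [y [xW yB xinj yinj xy]]; exists y, x; split=> // i j iw jb.
by rewrite adj_sym xy.
Qed.

Definition excludes (b w : nat) (p : nat -> nat -> bool) :=
  forall n, exists r s : rel 'I_n,
    [/\ separating r, separating s & ~ contains (lgrid r s) b w p].

Lemma excludes_unbounded H b w p : excludes b w p -> contains H b w p ->
  ~ bounded_cliquewidth (weakly_free H).
Proof.
move=> exp Hp; apply: unbounded_grids => n; have [r [s [sr ss rs]]] := exp n.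
exists r, s; split=> //.
exists (lines r s), (cells r s), (grid_bipartition r s) => HG.
exact/rs/(li_sub_contains HG).
Qed.

Lemma excludes_unbounded_opposite H b w p : excludes b w p ->
  contains H w b (transpose p) -> ~ bounded_cliquewidth (weakly_free H).
Proof.
move=> exp Hp; apply: unbounded_grids => n; have [r [s [sr ss rs]]] := exp n.
exists r, s; split=> //; apply: weakly_free_opposite.
exists (lines r s), (cells r s), (grid_bipartition r s) => HG.
apply: rs; apply: li_sub_contains HG _.
by apply: contains_opposite.
Qed.

Lemma eq_contains H b w p p' : (forall i j, i < b -> j < w -> p i j = p' i j) ->
  contains H b w p -> contains H b w p'.
Proof.
by move=> pp' [x [y [xB yW xi yi xy]]]; exists x, y; split=> // i j ib jw; rewrite xy ?pp'.
Qed.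

Lemma contains_lgrid n (r s : rel 'I_n) b w p : contains (lgrid r s) b w p ->
  exists (x : nat -> 'I_n + 'I_n) (y : nat -> 'I_n * 'I_n),
  [/\ {in gtn b &, injective x}, {in gtn w &, injective y} &
    forall i j, i < b -> j < w -> incident r s (y j) (x i) = p i j].
Proof.
case=> x [y [xB yW xi yi xy]].
pose x' i := match x i : grid_vertex n with inr l => l | inl c => inl c.1 end.
pose y' j := match y j : grid_vertex n with
  inl c => c | inr (inl k) | inr (inr k) => (k, k) end.
have xE i : i < b -> x i = inr (x' i).
  by rewrite /x' => /xB; rewrite inE; case: (x i).
have yE j : j < w -> y j = inl (y' j).
  by rewrite /y' => /yW; rewrite inE; case: (y j).
exists x', y'; split=> [i j ib jb xij|i j iw jw yij|i j ib jw].
- by apply: xi => //; rewrite !xE ?xij.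
- by apply: yi => //; rewrite !yE ?yij.
- by rewrite -xy // xE // yE.
Qed.

Definition eq_rel n (d : bool) : rel 'I_n := fun i j => (i == j) (+) d.

Lemma separating_eq_rel n d : separating (@eq_rel n d).
Proof.
by move=> i j ij; rewrite /eq_rel !eqxx (negbTE ij) eq_sym (negbTE ij); case: d; split=> -[].
Qed.

Lemma separating_geq n : separating (fun i j : 'I_n => j <= i).
Proof.
move=> i j; rewrite -val_eqE /= neq_ltn !leqnn => /orP[] ij.
  by rewrite (ltnW ij) leqNgt ij; split=> -[].
by rewrite (ltnW ij) leqNgt ij; split=> -[].
Qed.

(** A cell lies on exactly two lines, its row and its column; these are the lines it sees, or those
    it misses when [d] holds. *)
Lemma excludes_star d : excludes 3 1 (fun _ _ => ~~ d).
Proof.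
move=> n; exists (eq_rel d), (eq_rel d); split; [exact: separating_eq_rel..|].
move=> /contains_lgrid[x [y [xi _ xy]]].
have X i : i < 3 -> match x i with inl k => (y 0).1 == k | inr k => (y 0).2 == k end.
  move=> i3; have := xy i 0 i3 isT; rewrite /incident /eq_rel.
  by case: (x i) => k; case: eqP; case: (d).
have x01 : x 0 != x 1 by apply/eqP => /xi; rewrite !inE => /(_ isT isT).
have x02 : x 0 != x 2 by apply/eqP => /xi; rewrite !inE => /(_ isT isT).
have x12 : x 1 != x 2 by apply/eqP => /xi; rewrite !inE => /(_ isT isT).
move: x01 x02 x12 (X 0 isT) (X 1 isT) (X 2 isT).
by case: (x 0) => k0; case: (x 1) => k1; case: (x 2) => k2;
  move=> x01 x02 x12 /eqP e1 /eqP e2 /eqP e3; subst; move: x01 x02 x12; rewrite ?eqxx.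
Qed.

(** Two distinct lines share at most one cell. *)
Lemma excludes_C4 d : excludes 2 2 (fun _ _ => ~~ d).
Proof.
move=> n; exists (eq_rel d), (eq_rel d); split; [exact: separating_eq_rel..|].
move=> /contains_lgrid[x [y [xi yi xy]]].
have X i j : i < 2 -> j < 2 ->
    match x i with inl k => (y j).1 == k | inr k => (y j).2 == k end.
  move=> i2 j2; have := xy i j i2 j2; rewrite /incident /eq_rel.
  by case: (x i) => k; case: eqP; case: (d).
have x01 : x 0 != x 1 by apply/eqP => /xi; rewrite !inE => /(_ isT isT).
have y01 : y 0 != y 1 by apply/eqP => /yi; rewrite !inE => /(_ isT isT).
move: x01 (X 0 0 isT isT) (X 1 0 isT isT) (X 0 1 isT isT) (X 1 1 isT isT).
case: (x 0) => k0; case: (x 1) => k1 x01 /eqP e1 /eqP e2 /eqP e3 /eqP e4; subst;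
  rewrite ?eqxx // in x01; by case/eqP: y01; apply: injective_projections.
Qed.

(** Two of the three lines are both rows or both columns, and no cell lies on both. *)
Lemma excludes_C6 d : excludes 3 3 (fun i j => (i != j) (+) d).
Proof.
move=> n; exists (eq_rel d), (eq_rel d); split; [exact: separating_eq_rel..|].
move=> /contains_lgrid[x [y [xi yi xy]]].
have X i j : i < 3 -> j < 3 -> i != j ->
    match x i with inl k => (y j).1 == k | inr k => (y j).2 == k end.
  move=> i3 j3 ij; have := xy i j i3 j3; rewrite ij /incident /eq_rel.
  by case: (x i) => k; case: eqP; case: (d).
have x01 : x 0 != x 1 by apply/eqP => /xi; rewrite !inE => /(_ isT isT).
have x02 : x 0 != x 2 by apply/eqP => /xi; rewrite !inE => /(_ isT isT).
have x12 : x 1 != x 2 by apply/eqP => /xi; rewrite !inE => /(_ isT isT).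
move: x01 x02 x12 (X 0 1 isT isT isT) (X 2 1 isT isT isT) (X 0 2 isT isT isT)
  (X 1 2 isT isT isT) (X 1 0 isT isT isT) (X 2 0 isT isT isT).
by case: (x 0) => k0; case: (x 1) => k1; case: (x 2) => k2;
  move=> x01 x02 x12 /eqP e1 /eqP e2 /eqP e3 /eqP e4 /eqP e5 /eqP e6;
  first [by case/eqP: x02; rewrite -e1 -e2 | by case/eqP: x01; rewrite -e3 -e4
    | by case/eqP: x12; rewrite -e5 -e6].
Qed.

(** With the threshold relation, every row vertex seen by the upper-index-bounded cell [y 0] is seen
    by [y 1] as well. So both private neighbours of [y 0] would be its single column vertex. *)
Lemma excludes_2P3 : excludes 4 2 (fun i j => (j == 0) == (i < 2)).
Proof.
move=> n; exists (fun i j : 'I_n => j <= i), (eq_rel false).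
split; [exact: separating_geq|exact: separating_eq_rel|].
move=> /contains_lgrid[x [y [xi yi xy]]].
wlog y01 : x y xi yi xy / (y 0).1 <= (y 1).1.
  move=> H; case/orP: (leq_total (y 0).1 (y 1).1) => y01; first exact: (H x y).
  have g4 i : i < 4 -> (i + 2) %% 4 < 4 by move=> _; rewrite ltn_pmod.
  have f2 j : j < 2 -> 1 - j < 2 by move=> _; rewrite ltnS leq_subr.
  (* Exchange the two copies of $P_3$. *)
  apply: (H (fun i => x ((i + 2) %% 4)) (fun j => y (1 - j))) => //=.
  - move=> i j i4 j4 /xi; rewrite !inE => /(_ (g4 i i4) (g4 j j4)).
    by case: i i4 => [|[|[|[|i]]]] //; case: j j4 => [|[|[|[|j]]]].
  - move=> i j i2 j2 /yi; rewrite !inE => /(_ (f2 i i2) (f2 j j2)).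
    by case: i i2 => [|[|i]] //; case: j j2 => [|[|j]].
  - move=> i j i4 j2; rewrite xy ?g4 ?f2 //.
    by case: i i4 => [|[|[|[|i]]]] //; case: j j2 => [|[|j]].
have X i : i < 2 -> x i = inr (y 0).2.
  move=> i2; have i4 : i < 4 by apply: leq_trans i2 _.
  have := xy i 0 i4 isT; have := xy i 1 i4 isT; rewrite i2 /incident /eq_rel /=.
  case: (x i) => k; last by move=> _; case: ((y 0).2 =P k) => [->|].
  by move=> k1 k0; rewrite (leq_trans k0 y01) in k1.
by have := xi 0 1; rewrite !inE !X // => /(_ isT isT erefl).
Qed.

(** * Classification of the pattern-free labelled graphs *)

Fixpoint injections k (s : seq nat) : seq (seq nat) :=
  if k is k'.+1 then
    flatten [seq [seq x :: t | t <- injections k' (rem x s)] | x <- s]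
  else [:: [::]].

Lemma mem_injections k s t : uniq s ->
  (t \in injections k s) = [&& size t == k, uniq t & all [in s] t].
Proof.
elim: k s t => [|k IHk] s t us; first by case: t.
apply/flatten_mapP/idP => [[x xs /mapP[t' + ->]]|].
  rewrite IHk ?rem_uniq // => /and3P[/eqP <- ut' /allP t's] /=.
  rewrite eqxx ut' xs !andbT /=; apply/andP; split.
    by apply/negP => /t's; rewrite mem_rem_uniq // !inE eqxx.
  by apply/allP => y /t's; rewrite mem_rem_uniq // inE => /andP[].
case: t => // x t /and3P[st /= /andP[xt ut] /andP[xs ts]].
exists x => //; apply/mapP; exists t => //.
rewrite IHk ?rem_uniq //; apply/and3P; split=> //; apply/allP => y yt /=.
rewrite mem_rem_uniq // !inE (allP ts) // andbT.
by apply: contraNneq xt => <-.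
Qed.

(** The dimensions are stored because a matrix without rows does not determine its number of
    columns. *)
Definition pattern : eqType := (nat * nat * seq (seq bool))%type.
Definition Pattern b w m : pattern := (b, w, m).
Definition ncol (p : pattern) := p.1.1.
Definition nrow (p : pattern) := p.1.2.
Definition mat (p : pattern) := p.2.

Definition has_pattern H (p : pattern) := contains H (ncol p) (nrow p) (entry (mat p)).

Definition all_entries b w (q : nat -> nat -> bool) :=
  all (fun i => all (q i) (iota 0 w)) (iota 0 b).

Lemma all_entriesP b w (q : nat -> nat -> bool) :
  reflect (forall i j, i < b -> j < w -> q i j) (all_entries b w q).
Proof.
apply: (iffP allP) => [H i j ib jw|H i].
  have iH : i \in iota 0 b by rewrite mem_iota.
  by apply: (allP (H i iH)); rewrite mem_iota.
by rewrite mem_iota => ib; apply/allP => j; rewrite mem_iota => jw; apply: H.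
Qed.

Definition subpattern (p p' : pattern) :=
  has (fun r => has (fun c => all_entries (ncol p) (nrow p) (fun i j =>
      entry (mat p) i j == entry (mat p') (nth 0 c i) (nth 0 r j)))
    (injections (ncol p) (iota 0 (ncol p'))))
  (injections (nrow p) (iota 0 (nrow p'))).

Lemma has_subpattern H p p' : subpattern p p' -> has_pattern H p' -> has_pattern H p.
Proof.
case/hasP => r + /hasP[c + /all_entriesP pE].
rewrite !mem_injections ?iota_uniq // => /and3P[/eqP sr ur /allP rw]
  /and3P[/eqP sc uc /allP cb].
have ltr j : j < nrow p -> nth 0 r j < nrow p'.
  by rewrite -sr => /(mem_nth 0)/rw; rewrite /= mem_iota.
have ltc i : i < ncol p -> nth 0 c i < ncol p'.
  by rewrite -sc => /(mem_nth 0)/cb; rewrite /= mem_iota.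
case=> x [y [xB yW xi yi xy]]; exists (x \o nth 0 c), (y \o nth 0 r); split=> /=.
- by move=> i /ltc/xB.
- by move=> i /ltr/yW.
- move=> i j ib jb /xi; rewrite !inE => /(_ (ltc i ib) (ltc j jb))/eqP.
  by rewrite nth_uniq ?sc // => /eqP.
- move=> i j ib jb /yi; rewrite !inE => /(_ (ltr i ib) (ltr j jb))/eqP.
  by rewrite nth_uniq ?sr // => /eqP.
- by move=> i j ib jw; rewrite xy ?ltc ?ltr // (eqP (pE i j ib jw)).
Qed.

Definition obstructions : seq pattern :=
  flatten [seq [:: Pattern 3 1 [:: [:: c; c; c]]; Pattern 1 3 [:: [:: c]; [:: c]; [:: c]];
      Pattern 2 2 [:: [:: c; c]; [:: c; c]];
      Pattern 3 3 [:: [:: ~~ c; c; c]; [:: c; ~~ c; c]; [:: c; c; ~~ c]]]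
    | c <- [:: true; false]]
  ++ [:: Pattern 4 2 [:: [:: true; true; false; false]; [:: false; false; true; true]];
      Pattern 2 4 [:: [:: true; false]; [:: true; false]; [:: false; true]; [:: false; true]]].

Definition obstruction_free H := {in obstructions, forall p, ~ has_pattern H p}.

Lemma bounded_obstruction_free H :
  bounded_cliquewidth (weakly_free H) -> obstruction_free H.
Proof.
move=> bH p; rewrite mem_cat => /orP[/flatten_mapP[c _]|].
  rewrite !inE => /or4P[] /eqP-> Hp.
  - apply: (excludes_unbounded (excludes_star (~~ c)) _ bH); apply: eq_contains Hp.
    by case=> [|[|[|//]]] [|//] _ _; rewrite negbK.
  - apply: (excludes_unbounded_opposite (excludes_star (~~ c)) _ bH); apply: eq_contains Hp.
    by case=> [|//] [|[|[|//]]] _ _; rewrite /transpose negbK.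
  - apply: (excludes_unbounded (excludes_C4 (~~ c)) _ bH); apply: eq_contains Hp.
    by case=> [|[|//]] [|[|//]] _ _; rewrite negbK.
  - apply: (excludes_unbounded (excludes_C6 (~~ c)) _ bH); apply: eq_contains Hp.
    by case: (c) => -[|[|[|//]]] [|[|[|//]]].
rewrite !inE => /orP[] /eqP-> Hp.
  apply: (excludes_unbounded excludes_2P3 _ bH); apply: eq_contains Hp.
  by case=> [|[|[|[|//]]]] [|[|//]].
apply: (excludes_unbounded_opposite excludes_2P3 _ bH); apply: eq_contains Hp.
by case=> [|[|//]] [|[|[|[|//]]]].
Qed.

(** The matrices of $(2P_1+P_3)^b$ and its opposite, $(P_1+P_5)^b$ and its opposite, $P_2+P_4$ and
    $P_6$; all labellings of either of the last two graphs are isomorphic. *)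
Definition targets : seq pattern :=
  [:: Pattern 4 1 [:: [:: false; false; true; true]];
      Pattern 1 4 [:: [:: false]; [:: false]; [:: true]; [:: true]];
      Pattern 4 2 [:: [:: false; true; true; false]; [:: false; false; true; true]];
      Pattern 2 4 [:: [:: false; false]; [:: true; false]; [:: true; true]; [:: false; true]];
      Pattern 3 3 (mat_P6 true); Pattern 3 3 (mat_P6 false)].

Fixpoint words (T : Type) (s : seq T) n :=
  if n is n'.+1 then flatten [seq [seq x :: t | t <- words s n'] | x <- s] else [:: [::]].

Lemma mem_words (T : eqType) (s : seq T) n t :
  (t \in words s n) = (size t == n) && all [in s] t.
Proof.
elim: n t => [|n IHn] t; first by case: t.
apply/flatten_mapP/idP => [[x xs /mapP[t' + ->]]|]; first by rewrite IHn /= xs.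
case: t => // x t; rewrite /= eqSS => /and3P[st xs ts].
by exists x => //; apply/mapP; exists t; rewrite // IHn st.
Qed.

Definition obstructed p := has (fun o => subpattern o p) obstructions.

Definition embedded p := has (subpattern p) targets.

(* The extensions of m by n rows on top, pruned below obstructed matrices. *)
Fixpoint classified n b (m : seq (seq bool)) :=
  if obstructed (Pattern b (size m) m) then true else
  if embedded (Pattern b (size m) m) then
    if n is n'.+1 then all (fun r => classified n' b (r :: m)) (words [:: true; false] b)
    else true
  else false.

Lemma classifiedP n b m l : classified n b m -> size l <= n ->
  {in l, forall r, size r = b} ->
  (exists2 k, k <= size l & obstructed
    (Pattern b (size m + k) (drop (size l - k) (l ++ m)))) \/
  embedded (Pattern b (size l + size m) (l ++ m)).
Proof.
elim/last_ind: l n m => [|l r IHl] n m.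
  case: n => [|n] /=; case: ifP => [ob _ _ _|_]; try case: ifP => // em _ _ _;
    by [left; exists 0; rewrite ?addn0 // drop0 | right].
case: n => [|n] /=; first by rewrite size_rcons.
case: ifP => [ob _ _ _|_].
  by left; exists 0; rewrite // addn0 subn0 drop_size_cat.
case: ifP => // _ /allP H; rewrite size_rcons ltnS cat_rcons addSnnS => ln lb.
have [|r' r'l|[k kl ob]|em] := IHl n (r :: m) _ ln.
- by apply: H; rewrite mem_words lb ?mem_rcons ?mem_head ?eqxx //=; apply/allP => -[].
- by apply: lb; rewrite mem_rcons inE r'l orbT.
- by left; exists k.+1; rewrite // subSS -addSnnS.
- by right.
Qed.

Lemma small_classified : all (fun b => classified 4 b [::]) (iota 1 4).
Proof. by vm_cast_no_check (erefl true). Qed.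

(** Among five black vertices three agree on [w0], which gives an obstruction with parts of size 3
    and 1. *)
Lemma black_small H w0 : obstruction_free H -> w0 \in white H -> #|black H| <= 4.
Proof.
move=> free w0W; rewrite leqNgt; apply/negP => B4.
have [A cA [c cP]] : exists2 A : {set H}, 2 < #|A| & exists c : bool,
    forall u, u \in A -> u \in black H /\ adj u w0 = c.
  have := cardsID [set u | adj u w0] (black H).
  have [le2 cI|lt2 _] := leqP #|black H :&: [set u | adj u w0]| 2.
    exists (black H :\: [set u | adj u w0]).
      by move: B4; rewrite -cI => /leq_trans/(_ (leq_add le2 (leqnn _))); rewrite add2n !ltnS.
    by exists false => u; rewrite !inE => /andP[/negbTE].
  by exists (black H :&: [set u | adj u w0]) => //; exists true => u; rewrite !inE => /andP[].
have /card_gt2P[x [y [z [[xA yA zA] [xy yz zx]]]]] := cA.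
have [[xB xc] [yB yc] [zB zc]] := And3 (cP x xA) (cP y yA) (cP z zA).
apply: (free (Pattern 3 1 [:: [:: c; c; c]])).
  by rewrite mem_cat; case: (c).
apply: (@contains_seq H [:: x; y; z] [:: w0]) => //.
- by move=> u; rewrite !inE => /or3P[] /eqP->.
- by move=> u; rewrite inE => /eqP->.
- by rewrite /= !inE negb_or xy yz eq_sym zx.
- by rewrite /= xc yc zc.
Qed.

(** The list of obstructions is closed under transposition. *)
Lemma obstruction_free_opposite H : obstruction_free H -> obstruction_free (opposite H).
Proof.
move=> free p; rewrite mem_cat => /orP[/flatten_mapP[c cb]|].
  have inO q : q \in
     [:: Pattern 3 1 [:: [:: c; c; c]]; Pattern 1 3 [:: [:: c]; [:: c]; [:: c]];
      Pattern 2 2 [:: [:: c; c]; [:: c; c]];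
      Pattern 3 3 [:: [:: ~~ c; c; c]; [:: c; ~~ c; c]; [:: c; c; ~~ c]]] ->
    ~ has_pattern H q.
    by move=> qO; apply: free; rewrite mem_cat; apply/orP; left; apply/flatten_mapP; exists c.
  rewrite !inE => /or4P[] /eqP-> /contains_opposite Hp.
  - apply: (inO (Pattern 1 3 [:: [:: c]; [:: c]; [:: c]])); first by rewrite !inE eqxx ?orbT.
    by apply: eq_contains Hp; case=> [|//] [|[|[|//]]].
  - apply: (inO (Pattern 3 1 [:: [:: c; c; c]])); first by rewrite !inE eqxx ?orbT.
    by apply: eq_contains Hp; case=> [|[|[|//]]] [|//].
  - apply: (inO (Pattern 2 2 [:: [:: c; c]; [:: c; c]])); first by rewrite !inE eqxx ?orbT.
    by apply: eq_contains Hp; case=> [|[|//]] [|[|//]].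
  - apply: (inO (Pattern 3 3 [:: [:: ~~ c; c; c]; [:: c; ~~ c; c]; [:: c; c; ~~ c]])).
      by rewrite !inE eqxx ?orbT.
    by apply: eq_contains Hp; case=> [|[|[|//]]] [|[|[|//]]].
rewrite !inE => /orP[] /eqP-> /contains_opposite Hp.
  apply: (free (Pattern 2 4
    [:: [:: true; false]; [:: true; false]; [:: false; true]; [:: false; true]])).
    by rewrite mem_cat !inE eqxx !orbT.
  by apply: eq_contains Hp; case=> [|[|//]] [|[|[|[|//]]]].
apply: (free (Pattern 4 2 [:: [:: true; true; false; false]; [:: false; false; true; true]])).
  by rewrite mem_cat !inE eqxx !orbT.
by apply: eq_contains Hp; case=> [|[|[|[|//]]]] [|[|//]].
Qed.

Definition subtarget H := [\/ li_sub H twoP1_P3_b \/ li_sub H (opposite twoP1_P3_b),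
  li_sub H P1_P5_b \/ li_sub H (opposite P1_P5_b), li_sub H P2_P4_b | li_sub H (P_b 6)].

Lemma biadjacency_opposite H b w p p' : biadjacency H b w p ->
  (forall i j, i < b -> j < w -> p i j = p' j i) -> biadjacency (opposite H) w b p'.
Proof.
case=> x [y [[xB yW xi yi xy] xs ys]] pp'; exists y, x; split=> //; split=> // i j iw jb.
by rewrite adj_sym xy // pp'.
Qed.

Lemma obstruction_free_subtarget H : obstruction_free H ->
  black H != set0 -> white H != set0 -> subtarget H.
Proof.
move=> free /set0Pn[x0 x0B] /set0Pn[y0 y0W].
have B4 := black_small free y0W.
have W4 := black_small (obstruction_free_opposite free) x0B.
set b := #|black H| in B4; set w := #|white H| in W4.
have b0 : 0 < b by apply/card_gt0P; exists x0.
pose R := [seq [seq adj x y | x <- enum (black H)] | y <- enum (white H)].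
have sR : size R = w by rewrite size_map -cardE.
have Hsub : biadjacency H b w (entry R).
  rewrite /b /w !cardE; apply: biadjacency_seq => //.
  - by rewrite -cardE.
  - by move=> u; rewrite mem_enum.
  - by move=> u; rewrite mem_enum.
  - exact: enum_uniq.
  - exact: enum_uniq.
have HR : has_pattern H (Pattern b w R) := biadjacency_contains Hsub.
have unobstructed p : has_pattern H p -> ~ obstructed p.
  by move=> Hp /hasP[o oO /has_subpattern/(_ Hp)]; apply: free.
have cb : classified 4 b [::].
  by apply: (allP small_classified); rewrite mem_iota b0.
have [||[k kw ob]|/hasP[t tT tH]] := classifiedP (l := R) cb.
- by rewrite sR.
- by move=> r /mapP[y _ ->]; rewrite size_map -cardE.
- case: (unobstructed _ _ ob); rewrite cats0 add0n.
  have [x [y [xB yW xi yi xy]]] := HR.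
  rewrite sR in kw.
  (* The obstructed matrix consists of the last [k] rows of [R], hence the shift by [w - k]. *)
  exists x, (fun j => y (w - k + j)); split=> //=.
  + by move=> j jk; apply: yW; rewrite /nrow /= -{2}(subnK kw) ltn_add2l.
  + move=> i j ik jk /yi; rewrite !inE -{2 4}(subnK kw) !ltn_add2l => /(_ ik jk).
    by move/addnI.
  + move=> i j ib jk; rewrite xy //; last by rewrite /nrow /= -{2}(subnK kw) ltn_add2l.
    by rewrite /entry /= nth_drop sR.
rewrite addn0 cats0 sR in tH.
have sub T : biadjacency T (ncol t) (nrow t) (entry (mat t)) -> li_sub H T.
  move/biadjacency_contains => Tt; apply: biadjacency_li_sub Hsub _.
  exact: has_subpattern tH Tt.
move: tT sub; rewrite !inE => /orP[|/orP[|/or4P[]]] /eqP -> sub.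
- by constructor 1; left; apply: sub; exact: biadjacency_twoP1_P3_b.
- constructor 1; right; apply: sub; apply: biadjacency_opposite biadjacency_twoP1_P3_b _.
  by case=> [|[|[|[|//]]]] [|//].
- by constructor 2; left; apply: sub; exact: biadjacency_P1_P5_b.
- constructor 2; right; apply: sub; apply: biadjacency_opposite biadjacency_P1_P5_b _.
  by case=> [|[|[|[|//]]]] [|[|//]].
- by constructor 3; apply: sub; exact: biadjacency_P2_P4_b.
- by constructor 4; apply: sub; exact: biadjacency_P6_b.
Qed.

(** * Assembling the equivalence *)

Lemma liso_sP1_b H s : white H = set0 -> #|H| = s -> liso H (sP1_b s).
Proof.
move=> W0 <-; have Hbw := black_white H; have inW := bipartition_white Hbw.
have allB u : u \in black H by have := inW u; rewrite W0 inE => /esym/negbFE.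
exists (enum_rank : H -> sP1_b #|H|); split; last 2 first.
- by move=> u; rewrite allB inE.
- by move=> u; rewrite W0 !inE.
split; first exact: enum_rank_bij.
move=> u v; rewrite [LHS]/= /edgeless_adj; apply/esym/negP.
by move/(bipartition_adj Hbw); rewrite !allB.
Qed.

Lemma liso_li_sub H T : liso H T -> li_sub H T.
Proof.
case=> f [[fbij fadj] fB fW]; exists f; split; first by split; first exact: bij_inj.
  by move=> x; rewrite fB.
by move=> x; rewrite fW.
Qed.

Lemma liso_opposite H T : liso (opposite H) T -> liso H (opposite T).
Proof. by case=> f [fi fB fW]; exists f. Qed.

Lemma obstruction_free_cases H : obstruction_free H ->
  (exists s, 1 <= s /\ (liso H (sP1_b s) \/ liso H (opposite (sP1_b s)))) \/ subtarget H.
Proof.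
move=> free; have [W0|W0] := eqVneq (white H) set0; last first.
  have [B0|B0] := eqVneq (black H) set0; last by right; apply: obstruction_free_subtarget.
  left; exists #|H|; split; last by right; apply: liso_opposite; exact: liso_sP1_b.
  by case/set0Pn: W0 => u _; apply/card_gt0P; exists u.
(* The empty graph is excluded from the first case by [1 <= s] and is embedded in $P_6$ instead. *)
have [H0|H0] := eqVneq #|H| 0; last first.
  by left; exists #|H|; rewrite lt0n; split=> //; left; exact: liso_sP1_b.
right; constructor 4.
have noH (u : H) : False by have := card0_eq H0 u; rewrite inE.
by exists (fun u => False_rect _ (noH u)); split; [split|..] => u; case: (noH u).
Qed.

Lemma subtarget_bounded H : subtarget H -> bounded_cliquewidth (weakly_free H).
Proof.
case=> [[]|[]||] => /bounded_sub; apply.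
- exact: bounded_twoP1_P3_b.
- exact/bounded_opposite/bounded_twoP1_P3_b.
- exact: bounded_P1_P5_b.
- exact/bounded_opposite/bounded_P1_P5_b.
- exact: bounded_P2_P4_b.
- exact: bounded_P6_b.
Qed.

Lemma sP1_bounded H s : liso H (sP1_b s) \/ liso H (opposite (sP1_b s)) ->
  bounded_cliquewidth (weakly_free H).
Proof.
case=> /liso_li_sub/bounded_sub; apply; first exact: bounded_sP1_b.
exact/bounded_opposite/bounded_sP1_b.
Qed.

Lemma obstruction_free_bounded H : obstruction_free H ->
  bounded_cliquewidth (weakly_free H).
Proof.
case/obstruction_free_cases => [[s [_ Hs]]|]; first exact: sP1_bounded Hs.
exact: subtarget_bounded.
Qed.

(* Unlabelled occurrences of p in a graph on {0, ..., 5} with adjacency a: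
   the first ncol p entries of t are the columns, the others the rows. *)
Definition unlabelled_pattern (a : rel nat) (p : pattern) :=
  has (fun t => let c := take (ncol p) t in let r := drop (ncol p) t in
    [&& all_entries (ncol p) (nrow p) (fun i j =>
          a (nth 0 c i) (nth 0 r j) == entry (mat p) i j),
        all_entries (ncol p) (ncol p) (fun i j => ~~ a (nth 0 c i) (nth 0 c j)) &
        all_entries (nrow p) (nrow p) (fun i j => ~~ a (nth 0 r i) (nth 0 r j))])
  (injections (ncol p + nrow p) (iota 0 6)).

(** The labelling of [H] is arbitrary here, so obstructions are sought in [K] under every labelling
    at once; coding the vertices by numbers lets this search be computed. *)
Lemma unlabelled_obstruction_free (H : lbigraph) (K : sgraph) (a : rel nat) (code : K -> nat) :
    induced_sub H K -> injective code -> (forall u, code u < 6) ->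
    (forall u v, adj u v = a (code u) (code v)) ->
    all (fun p => ~~ unlabelled_pattern a p) obstructions ->
  obstruction_free H.
Proof.
move=> [f [finj fadj]] cinj c6 cadj /allP noK p /noK + [x [y [xB yW xi yi xy]]].
have Hbw := black_white H.
case/hasP; pose cols := mkseq (fun i => code (f (x i))) (ncol p).
pose rows := mkseq (fun j => code (f (y j))) (nrow p).
have adjE u v : a (code (f u)) (code (f v)) = adj u v by rewrite -cadj fadj.
have whiteN u : u \in white H -> u \notin black H by rewrite (bipartition_white Hbw).
have in6 u : code u \in iota 0 6 by rewrite mem_iota c6.
have sc : size cols = ncol p by rewrite size_mkseq.
exists (cols ++ rows).
  rewrite mem_injections ?iota_uniq // size_cat !size_mkseq eqxx andTb.
  rewrite cat_uniq all_cat; apply/andP; split; [apply/and3P; split|apply/andP; split].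
  - rewrite map_inj_in_uniq ?iota_uniq // => i j; rewrite !mem_iota => ib jb.
    by move/cinj/finj/xi; apply.
  - apply/hasPn => _ /mapP[j jw ->]; apply/mapP => -[i ib /cinj/finj yx].
    rewrite !mem_iota in ib jw.
    by have := whiteN _ (yW j jw); rewrite yx xB.
  - rewrite map_inj_in_uniq ?iota_uniq // => i j; rewrite !mem_iota => ib jb.
    by move/cinj/finj/yi; apply.
  - by apply/allP => _ /mapP[i _ ->]; exact: in6.
  - by apply/allP => _ /mapP[i _ ->]; exact: in6.
rewrite -sc take_size_cat // drop_size_cat // sc.
apply/and3P; split; apply/all_entriesP => i j ib jw; rewrite !nth_mkseq // adjE.
- by rewrite xy.
- by apply/negP => /(bipartition_adj Hbw); rewrite !xB.
- by apply/negP => /(bipartition_adj Hbw); rewrite !(negbTE (whiteN _ (yW _ _))).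
Qed.

Definition path_code (i j : nat) := (i.+1 == j) || (j.+1 == i).

Lemma P6_obstruction_free (H : lbigraph) : induced_sub H (P 6) -> obstruction_free H.
Proof.
move=> HP; pose code (u : P 6) := nat_of_ord u.
apply: (@unlabelled_obstruction_free H (P 6) path_code code HP).
- exact: val_inj.
- by move=> u; exact: ltn_ord.
- by [].
- by vm_cast_no_check (erefl true).
Qed.

Lemma P2_P4_obstruction_free (H : lbigraph) :
  induced_sub H (gunion (P 2) (P 4)) -> obstruction_free H.
Proof.
(* Deleting the edge between 1 and 2 from the path on 0, ..., 5 leaves $P_2+P_4$. *)
pose a i j := path_code i j && ((i < 2) == (j < 2)).
pose code (u : gunion (P 2) (P 4)) : nat :=
  match u with inl i => i | inr i => i.+2 end.
move=> HP; apply: (@unlabelled_obstruction_free H _ a code HP).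
- move=> [i|i] [j|j] //=.
  + by move/val_inj->.
  + by move=> ij; have := ltn_ord i; rewrite ij.
  + by move=> ij; have := ltn_ord j; rewrite -ij.
  + by case=> /val_inj->.
- by case=> i; [exact: leq_trans (ltn_ord i) _ | exact: (ltn_ord i)].
- move=> [i|i] [j|j] //=; rewrite /a /path_code ?ltn_ord ?eqxx ?andbT //.
  + by rewrite andbF.
  + by rewrite andbF.
- by vm_cast_no_check (erefl true).
Qed.

Theorem theorem3 (H : lbigraph) :
  bounded_cliquewidth (weakly_free H) <->
  (exists s : nat, 1 <= s /\ (liso H (sP1_b s) \/ liso H (opposite (sP1_b s)))) \/
  (li_sub H twoP1_P3_b \/ li_sub H (opposite twoP1_P3_b)) \/
  (li_sub H P1_P5_b \/ li_sub H (opposite P1_P5_b)) \/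
  induced_sub H (gunion (P 2) (P 4)) \/
  induced_sub H (P 6).
Proof.
have li_induced T : li_sub H T -> induced_sub H T by case=> f [fe _ _]; exists f.
split=> [/bounded_obstruction_free/obstruction_free_cases[|[|||]]|].
- by left.
- by right; left.
- by do 2!right; left.
- by move/li_induced; do 3!right; left.
- by move/li_induced; do 4!right.
case=> [[s [_ Hs]]|[Hs|[Hs|[Hs|Hs]]]].
- exact: sP1_bounded Hs.
- by apply: subtarget_bounded; constructor 1.
- by apply: subtarget_bounded; constructor 2.
- exact/obstruction_free_bounded/P2_P4_obstruction_free.
- exact/obstruction_free_bounded/P6_obstruction_free.
Qed.
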